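(* Let $T:\mathcal{M}_d(\mathbb{C})\to\mathcal{M}_d(\mathbb{C})$ be a trace-preserving Schwarz map and let $\mathcal{X}_T:=\mathrm{span}\{X\in\mathcal{M}_d(\mathbb{C}):\exists\varphi\in\mathbb{R},\ T(X)=e^{i\varphi}X\}$. (1) There exist an orthogonal direct sum decomposition $\mathbb{C}^d=\mathcal{H}_0\oplus\bigoplus_{k=1}^K\mathcal{H}_k$ with $\mathcal{H}_k=\mathcal{H}_{k,1}\otimes\mathcal{H}_{k,2}$ (where $\dim\mathcal{H}_0=0$ and $\dim\mathcal{H}_{k,i}=1$ are allowed), and positive definite density matrices $\rho_k$ on $\mathcal{H}_{k,2}$, such that $$\mathcal{X}_T=\Big\{0\oplus\bigoplus_{k=1}^K x_k\otimes\rho_k:\ x_k\in\mathcal{B}(\mathcal{H}_{k,1})\Big\},$$ i.e. $\mathcal{X}_T=0\oplus\bigoplus_k\mathcal{M}_{d_k}\otimes\rho_k$ with $d_k=\dim\mathcal{H}_{k,1}$. (2) There exist unitaries $U_k\in\mathcal{B}(\mathcal{H}_{k,1})$ and a permutation $\pi$ of $\{1,\dots,K\}$ satisfying $d_{\pi(k)}=d_k$ for all $k$, such that for every $X=0\oplus\bigoplus_kx_k\otimes\rho_k\in\mathcal{X}_T$, $$T(X)=0\oplus\bigoplus_{k=1}^KU_kx_{\pi(k)}U_k^\dagger\otimes\rho_k.$$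
   Context: A positive trace-preserving linear map $T$ on $\mathcal{M}_d(\mathbb{C})$ is a Schwarz map if its adjoint $T^*$ (defined by $\mathrm{tr}[AT^*(B)]=\mathrm{tr}[T(A)B]$) satisfies $T^*(A^\dagger A)\ge T^*(A^\dagger)T^*(A)$ for all $A\in\mathcal{M}_d(\mathbb{C})$; every completely positive trace-preserving map is a Schwarz map. Positive: maps positive semidefinite matrices to positive semidefinite matrices; trace-preserving: $\mathrm{tr}[T(X)]=\mathrm{tr}[X]$. $\mathcal{B}(\mathcal{H})$ denotes all linear operators on $\mathcal{H}$; the direct sum is orthogonal but need not be a block structure in the computational basis. *)

(* Defs.v *)
From HB Require Import structures.
From mathcomp Require Import all_boot all_order all_algebra.
From mathcomp Require Import sesquilinear spectral.
Set Implicit Arguments.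
Unset Strict Implicit.
Unset Printing Implicit Defensive.
Import Order.TTheory GRing.Theory Num.Theory.
Local Open Scope ring_scope.

Section Defs.
Variable C : numClosedFieldType.

Definition adjmx m n (A : 'M[C]_(m, n)) : 'M[C]_(n, m) := (A ^t* )%sesqui.

Definition psdmx n (A : 'M[C]_n) : Prop :=
  A \is hermsymmx /\ forall v : 'rV[C]_n, 0 <= (v *m A *m adjmx v) 0 0.
Definition pdmx n (A : 'M[C]_n) : Prop :=
  A \is hermsymmx /\ forall v : 'rV[C]_n, v != 0 -> 0 < (v *m A *m adjmx v) 0 0.
Definition pd_density n (A : 'M[C]_n) : Prop := pdmx A /\ \tr A = 1.

(* Kronecker (tensor) product, standard ordering (i1,i2) |-> i1 * m2 + i2 *)
Definition kronmx m1 n1 m2 n2 (A : 'M[C]_(m1, n1)) (B : 'M[C]_(m2, n2))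
  : 'M[C]_(m1 * m2, n1 * n2) :=
  \matrix_(k, l)
    let: (i1, i2) := pair_of_mxvec_index (mxvec_indexP k) in
    let: (j1, j2) := pair_of_mxvec_index (mxvec_indexP l) in
    A i1 j1 * B i2 j2.

Variable d : nat.

Definition positive_map (T : 'M[C]_d -> 'M[C]_d) : Prop :=
  forall X, psdmx X -> psdmx (T X).
Definition trace_preserving (T : 'M[C]_d -> 'M[C]_d) : Prop :=
  forall X, \tr (T X) = \tr X.
Definition is_adjoint_map (T Tstar : 'M[C]_d -> 'M[C]_d) : Prop :=
  forall A B, \tr (A *m Tstar B) = \tr (T A *m B).
Definition tp_schwarz_map (T : 'M[C]_d -> 'M[C]_d) : Prop :=
  linear T /\ positive_map T /\ trace_preserving T /\
  exists Tstar, is_adjoint_map T Tstar /\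
    forall A, psdmx (Tstar (adjmx A *m A) - Tstar (adjmx A) *m Tstar A).

Definition peripheral (T : 'M[C]_d -> 'M[C]_d) (X : 'M[C]_d) : Prop :=
  exists lam : C, `|lam| = 1 /\ T X = lam *: X.
Definition in_XT (T : 'M[C]_d -> 'M[C]_d) (X : 'M[C]_d) : Prop :=
  exists (n : nat) (c : 'I_n -> C) (Y : 'I_n -> 'M[C]_d),
    (forall i, peripheral T (Y i)) /\ X = \sum_(i < n) c i *: Y i.

(* W^dagger (0 (+) (+)_k x_k (x) rho_k) W, where the rows of the unitary W
   give the orthonormal basis adapted to C^d = H_0 (+) (+)_k H_k1 (x) H_k2 *)
Definition embed (d0 K : nat) (d1 d2 : 'I_K -> nat)
  (W : 'M[C]_(d0 + \sum_(k < K) (d1 k * d2 k), d))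
  (rho : forall k, 'M[C]_(d2 k)) (x : forall k, 'M[C]_(d1 k)) : 'M[C]_d :=
  adjmx W *m block_mx (0 : 'M[C]_d0) 0 0
     (\mxdiag_(k < K) kronmx (x k) (rho k)) *m W.

End Defs.

(* Main.v *)
Require Import Defs.
From HB Require Import structures.
From mathcomp Require Import all_boot all_order all_algebra.
From mathcomp Require Import fingroup perm sesquilinear spectral.
From mathcomp Require Import ring.
From Stdlib Require Import Classical.
Import Order.TTheory GRing.Theory Num.Theory.
Local Open Scope ring_scope.

(** Write [E] for the adjoint of [T], a unital Schwarz map.  As [C] is an
    arbitrary closed numeric field, no limits of powers of [T] are taken.

    If [T Y = l Y] with [|l| = 1], the equality case of the Cauchy-Schwarz and
    Schwarz inequalities for the polar decomposition of [Y] shows that the modulus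
    of [Y^!] is fixed by [T].  Hence every peripheral eigenvector lives on the
    support of a fixed point [s >= 0] of maximal rank, and compressing to this
    support reduces to the case where [s] is positive definite.

    In that case the Schwarz defect of a peripheral eigenvector of [E] vanishes, so
    the span [N] of these eigenvectors is a star-algebra on which [E] is
    multiplicative; moreover [X_T = N s], [X_T] is an [N]-bimodule, and [X_T] and
    [N] are in perfect duality under the trace.  With [N = (+)_k M_(d_k) (x) 1] and
    [rho_k] the normalised corner of [s] at a minimal projection of the [k]-th
    block, the operators [x (x) rho_k] lie in [X_T], and duality shows that they
    span it.  Finally, the inverse of [E] on [N] is a star-automorphism: it permutes
    the minimal central projections and is inner between blocks; transposing it
    through the duality gives the action of [T]. *)

Set Implicit Arguments.
Unset Strict Implicit.
Unset Printing Implicit Defensive.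

Local Notation "A ^!" := (adjmx A) (at level 1, format "A ^!").

(** * Conjugate transposes and the Hilbert-Schmidt inner product *)

Section Adjoint.
Variable C : numClosedFieldType.

Lemma adjmxE m n (A : 'M[C]_(m, n)) i j : A^! i j = (A j i)^*.
Proof. by rewrite !mxE. Qed.

Lemma adjmxK m n (A : 'M[C]_(m, n)) : A^!^! = A.
Proof. exact: trmxCK. Qed.

Lemma adjmxM m n p (A : 'M[C]_(m, n)) (B : 'M_(n, p)) :
  (A *m B)^! = B^! *m A^!.
Proof. by rewrite /adjmx trmx_mul map_mxM. Qed.

Lemma adjmxD m n (A B : 'M[C]_(m, n)) : (A + B)^! = A^! + B^!.
Proof. by rewrite /adjmx linearD map_mxD. Qed.

Lemma adjmxN m n (A : 'M[C]_(m, n)) : (- A)^! = - A^!.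
Proof. by rewrite /adjmx linearN map_mxN. Qed.

Lemma adjmxB m n (A B : 'M[C]_(m, n)) : (A - B)^! = A^! - B^!.
Proof. by rewrite adjmxD adjmxN. Qed.

Lemma adjmxZ m n a (A : 'M[C]_(m, n)) : (a *: A)^! = a^* *: A^!.
Proof. by apply/matrixP => i j; rewrite !mxE rmorphM. Qed.

Lemma adjmx0 m n : (0 : 'M[C]_(m, n))^! = 0.
Proof. by apply/matrixP => i j; rewrite !mxE conjC0. Qed.

Lemma adjmx_scalar n (a : C) : (a%:M : 'M_n)^! = (a^*)%:M.
Proof. by rewrite /adjmx tr_scalar_mx map_scalar_mx. Qed.

Lemma adjmx1 n : (1%:M : 'M[C]_n)^! = 1%:M.
Proof. by rewrite adjmx_scalar conjC1. Qed.

Lemma adjmx_sum m n I (r : seq I) (P : pred I) (F : I -> 'M[C]_(m, n)) :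
  (\sum_(i <- r | P i) F i)^! = \sum_(i <- r | P i) (F i)^!.
Proof.
elim/big_rec2: _ => [|i A B _ <-]; first exact: adjmx0.
by rewrite adjmxD.
Qed.

Lemma adjmx_diag n (s : 'rV[C]_n) :
  (diag_mx s)^! = diag_mx (\row_i (s 0 i)^*).
Proof.
apply/matrixP => i j; rewrite !mxE eq_sym.
by case: eqP => [->|]; rewrite ?mulr1n // !mulr0n conjC0.
Qed.

Lemma mxtrace_adj n (A : 'M[C]_n) : \tr A^! = (\tr A)^*.
Proof. by rewrite /mxtrace rmorph_sum; apply: eq_bigr => i _; rewrite adjmxE. Qed.

Lemma adjmx_inj m n : injective (@adjmx C m n).
Proof. exact: can_inj (@adjmxK m n). Qed.

Lemma hermP n (A : 'M[C]_n) : A \is hermsymmx <-> A^! = A.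
Proof.
split=> [/is_hermitianmxP|h]; first by rewrite expr0 scale1r => {2}->.
by apply/is_hermitianmxP; rewrite expr0 scale1r -[LHS]h.
Qed.

Lemma unitarymx_adjP m n (A : 'M[C]_(m, n)) :
  A \is unitarymx <-> A *m A^! = 1%:M.
Proof. by split=> /unitarymxP. Qed.

Lemma mxtrace_adjmul m n (A : 'M[C]_(m, n)) :
  \tr (A^! *m A) = \sum_i \sum_j `|A j i| ^+ 2.
Proof.
apply: eq_bigr => i _; rewrite mxE; apply: eq_bigr => j _.
by rewrite adjmxE normCKC.
Qed.

Lemma adjmul_tr_ge0 m n (A : 'M[C]_(m, n)) : 0 <= \tr (A^! *m A).
Proof.
by rewrite mxtrace_adjmul; do 2!apply: sumr_ge0 => ? _; rewrite exprn_ge0.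
Qed.

Lemma adjmul_tr_eq0 m n (A : 'M[C]_(m, n)) : \tr (A^! *m A) = 0 -> A = 0.
Proof.
rewrite mxtrace_adjmul => /eqP; rewrite psumr_eq0 => [/allP h|i _]; last first.
  by apply: sumr_ge0 => j _; rewrite exprn_ge0.
apply/matrixP => j i; have := h i (mem_index_enum _).
rewrite /= psumr_eq0 => [/allP/(_ j (mem_index_enum _))|k _]; last first.
  by rewrite exprn_ge0.
by rewrite /= expf_eq0 normr_eq0 mxE => /eqP.
Qed.

Lemma adjmul_eq0 m n (A : 'M[C]_(m, n)) : A^! *m A = 0 -> A = 0.
Proof. by move=> h; apply: adjmul_tr_eq0; rewrite h mxtrace0. Qed.

Lemma muladj_eq0 m n (A : 'M[C]_(m, n)) : A *m A^! = 0 -> A = 0.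
Proof.
move=> h; apply: adjmx_inj; rewrite adjmx0; apply: adjmul_eq0.
by rewrite adjmxK.
Qed.

(** Testing with [X = (A - B)^!] gives a vanishing Hilbert-Schmidt norm. This nondegeneracy is what
    carries identities from a map to its adjoint. *)
Lemma mxtrace_pairing_inj n (A B : 'M[C]_n) :
  (forall X, \tr (X *m A) = \tr (X *m B)) -> A = B.
Proof.
move=> h; apply/eqP; rewrite -subr_eq0; apply/eqP/adjmul_tr_eq0.
by rewrite mulmxBr linearB /= h subrr.
Qed.

End Adjoint.

(** * Positive semidefinite matrices *)

Section Psd.
Variable C : numClosedFieldType.
Implicit Types n : nat.

Lemma psd_adj n (A : 'M[C]_n) : psdmx A -> A^! = A.
Proof. by case=> /hermP. Qed.

Lemma psd_adjmul m n (A : 'M[C]_(m, n)) : psdmx (A^! *m A).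
Proof.
split; first by apply/hermP; rewrite adjmxM adjmxK.
move=> v; rewrite mulmxA -mulmxA -[A *m v^!]adjmxK adjmxM adjmxK.
by rewrite -trace_mx11 mxtrace_mulC; exact: adjmul_tr_ge0.
Qed.

Lemma psd_congr m n (B : 'M[C]_(m, n)) (A : 'M_n) :
  psdmx A -> psdmx (B *m A *m B^!).
Proof.
case=> /hermP hA pA; split.
  by apply/hermP; rewrite !adjmxM adjmxK hA mulmxA.
by move=> v; have := pA (v *m B); rewrite adjmxM !mulmxA.
Qed.

Lemma psdD n (A B : 'M[C]_n) : psdmx A -> psdmx B -> psdmx (A + B).
Proof.
case=> /hermP hA pA [/hermP hB pB]; split.
  by apply/hermP; rewrite adjmxD hA hB.
by move=> v; rewrite mulmxDr mulmxDl mxE addr_ge0.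
Qed.

Lemma psd0 n : psdmx (0 : 'M[C]_n).
Proof.
split; first by apply/hermP; rewrite adjmx0.
by move=> v; rewrite mulmx0 mul0mx mxE.
Qed.

Lemma psdZ n a (A : 'M[C]_n) : 0 <= a -> psdmx A -> psdmx (a *: A).
Proof.
move=> a0 [/hermP hA pA]; split.
  by apply/hermP; rewrite adjmxZ hA (CrealP (ger0_real a0)).
by move=> v; rewrite -scalemxAr -scalemxAl mxE mulr_ge0.
Qed.

Lemma herm_spectral n (A : 'M[C]_n) : A^! = A ->
  exists (P : 'M[C]_n) (s : 'rV[C]_n),
    [/\ P *m P^! = 1%:M, P^! *m P = 1%:M & A = P^! *m diag_mx s *m P].
Proof.
move=> /hermP/hermitian_normalmx/orthomx_spectralP ->.
set P := spectralmx A; have uP : P \is unitarymx by exact: spectral_unitarymx.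
have PP : P *m P^! = 1%:M by apply/unitarymx_adjP.
exists P, (spectral_diag A); rewrite invmx_unitary //; split=> //.
exact: mulmx1C.
Qed.

Lemma psd_spectral n (A : 'M[C]_n) : psdmx A ->
  exists (P : 'M[C]_n) (s : 'rV[C]_n),
    [/\ P *m P^! = 1%:M, P^! *m P = 1%:M, A = P^! *m diag_mx s *m P &
        forall i, 0 <= s 0 i].
Proof.
case=> /hermP hA pA; have [P [s [PP PP' AE]]] := herm_spectral hA.
exists P, s; split=> // i.
pose e : 'rV[C]_n := delta_mx 0 i.
have := pA (row i P); rewrite AE rowE -/e adjmxM.
have -> : e *m P *m (P^! *m diag_mx s *m P) *m (P^! *m e^!) =
    e *m (P *m P^!) *m diag_mx s *m (P *m P^!) *m e^! by rewrite !mulmxA.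
rewrite PP !mulmx1 -rowE mxE (bigD1 i) //= big1 ?addr0 => [|j ji].
  by rewrite !mxE !eqxx conjC1 mulr1 mulr1n.
by rewrite !mxE (negPf ji) conjC0 mulr0.
Qed.

(** [R] is the square root and [S] its Moore-Penrose inverse, both computed on the spectrum; this
    makes polar decompositions available for singular matrices. *)
Lemma psd_sqrt n (A : 'M[C]_n) : psdmx A ->
  exists R S : 'M[C]_n,
    [/\ psdmx R /\ S^! = S, R *m R = A, S *m R = R *m S, R *m S *m R = R &
        S *m R *m S = S].
Proof.
move=> /psd_spectral [P [s [PP PP' -> s0]]].
pose r : 'rV[C]_n := \row_i sqrtC (s 0 i).
(* At a zero eigenvalue the convention [0^-1 = 0] yields the pseudo-inverse. *)
pose t : 'rV[C]_n := \row_i (sqrtC (s 0 i))^-1.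
have r0 i : 0 <= r 0 i by rewrite mxE sqrtC_ge0.
pose f (u : 'rV[C]_n) := P^! *m diag_mx u *m P.
have fM (u v : 'rV[C]_n) : f u *m f v = P^! *m (diag_mx u *m diag_mx v) *m P.
  rewrite /f !mulmxA -[X in _ = X *m _ *m _](mulmx1 (P^! *m diag_mx u)) -PP.
  by rewrite !mulmxA.
have f_adj (u : 'rV[C]_n) : (forall i, 0 <= u 0 i) -> (f u)^! = f u.
  move=> u0; rewrite /f !adjmxM adjmxK mulmxA adjmx_diag; congr (_ *m diag_mx _ *m _).
  by apply/rowP => i; rewrite mxE (CrealP (ger0_real (u0 i))).
have rt i : r 0 i * t 0 i * r 0 i = r 0 i /\ t 0 i * r 0 i * t 0 i = t 0 i.
  rewrite !mxE; have [->|ne] := eqVneq (sqrtC (s 0 i)) 0.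
    by rewrite invr0 !mulr0.
  by rewrite divff // mulVf // !mul1r.
exists (f r), (f t); split; first split.
- pose q : 'rV[C]_n := \row_i sqrtC (r 0 i).
  have -> : f r = f q *m f q.
    rewrite fM mulmx_diag; congr (_ *m diag_mx _ *m _).
    by apply/rowP => i; rewrite !mxE -expr2 sqrtCK.
  rewrite -{1}[f q]f_adj; first exact: psd_adjmul.
  by move=> i; rewrite mxE sqrtC_ge0.
- by apply: f_adj => i; rewrite mxE invr_ge0 sqrtC_ge0.
- rewrite fM mulmx_diag; congr (_ *m diag_mx _ *m _).
  by apply/rowP => i; rewrite !mxE -expr2 sqrtCK.
- by rewrite !fM diag_mxC.
- rewrite fM mulmx_diag -/(f _) fM mulmx_diag; congr (_ *m diag_mx _ *m _).
  by apply/rowP => i; rewrite !mxE; have [] := rt i; rewrite !mxE.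
- rewrite fM mulmx_diag -/(f _) fM mulmx_diag; congr (_ *m diag_mx _ *m _).
  by apply/rowP => i; rewrite !mxE; have [] := rt i; rewrite !mxE.
Qed.

Lemma psd_factor n (A : 'M[C]_n) : psdmx A -> exists F : 'M[C]_n, A = F^! *m F.
Proof.
by move=> /psd_sqrt [R [S [[/psd_adj hR _] <- _ _ _]]]; exists R; rewrite hR.
Qed.

Lemma psd_tr_mul_ge0 n (A B : 'M[C]_n) :
  psdmx A -> psdmx B -> 0 <= \tr (A *m B).
Proof.
move=> /psd_factor [F ->] /psd_factor [G ->].
rewrite mulmxA mxtrace_mulC !mulmxA -mulmxA -[G *m F^!]adjmxK adjmxM adjmxK.
exact: adjmul_tr_ge0.
Qed.

(** With [A = F^! *m F] and [B = G^! *m G], the trace is the squared norm of [F *m G^!], a factor of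
    [A *m B]. *)
Lemma psd_tr_mul_eq0 n (A B : 'M[C]_n) :
  psdmx A -> psdmx B -> \tr (A *m B) = 0 -> A *m B = 0.
Proof.
move=> /psd_factor [F ->] /psd_factor [G ->].
rewrite mulmxA mxtrace_mulC !mulmxA -mulmxA -[G *m F^!]adjmxK adjmxM adjmxK.
move=> /adjmul_tr_eq0 h; rewrite -[_ *m F *m _]mulmxA h mulmx0 mul0mx //.
Qed.

Lemma psd1 n : psdmx (1%:M : 'M[C]_n).
Proof. by rewrite -[1%:M]mulmx1 -{1}adjmx1; exact: psd_adjmul. Qed.

Lemma psd_tr_ge0 n (A : 'M[C]_n) : psdmx A -> 0 <= \tr A.
Proof. by move=> /psd_tr_mul_ge0/(_ (psd1 _)); rewrite mulmx1. Qed.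

Lemma psd_tr_eq0 n (A : 'M[C]_n) : psdmx A -> \tr A = 0 -> A = 0.
Proof. by move=> pA; have := psd_tr_mul_eq0 pA (psd1 n); rewrite mulmx1. Qed.

Lemma psd_congr_eq0 m n (B : 'M[C]_(m, n)) (A : 'M_n) :
  psdmx A -> B *m A *m B^! = 0 -> B *m A = 0.
Proof.
move=> /psd_factor [F ->]; rewrite !mulmxA -[_ *m F *m _]mulmxA.
rewrite -[F *m B^!]adjmxK adjmxM adjmxK.
by move=> /muladj_eq0 ->; rewrite mul0mx.
Qed.

Lemma psd_rv11 n (A : 'M[C]_n) (v : 'rV[C]_n) : \tr (v^! *m v *m A) = (v *m A *m v^!) 0 0.
Proof. by rewrite -trace_mx11 -mulmxA mxtrace_mulC. Qed.

Lemma psd_of_tr n (A : 'M[C]_n) : A^! = A ->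
  (forall B, psdmx B -> 0 <= \tr (B *m A)) -> psdmx A.
Proof.
move=> hA h; split; first exact/hermP.
by move=> v; rewrite -psd_rv11; apply/h/psd_adjmul.
Qed.

(** Polarisation: positive semidefinite matrices span all matrices, so linear properties may be
    checked on them. *)
Lemma psd_span_ind n (P : 'M[C]_n -> Prop) :
  (forall a A B, P A -> P B -> P (a *: A + B)) ->
  (forall A, psdmx A -> P A) -> forall A, P A.
Proof.
move=> Plin Ppsd.
have P0 : P 0 by apply/Ppsd/psd0.
have PZ a A : P A -> P (a *: A) by move=> pA; rewrite -[_ *: _]addr0; apply: Plin.
have Pherm (A : 'M_n) : A^! = A -> P A.
  move=> hA; have h (e : C) : e^* = e -> psdmx ((A + e%:M) *m (A + e%:M)).
    by move=> eE; rewrite -{1}hA -{1}eE -adjmx_scalar -adjmxD; exact: psd_adjmul.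
  (* This is [4 A = (A + 1)^2 - (A - 1)^2], where both squares are positive because [A] is
     Hermitian. *)
  have -> : A = (4%:R)^-1 *: ((-1) *: ((A + (-1)%:M) *m (A + (-1)%:M)) +
                 (A + 1%:M) *m (A + 1%:M)).
    have E (e : C) : (A + e%:M) *m (A + e%:M) =
        A *m A + ((e + e) *: A + (e * e)%:M).
      rewrite mulmxDr !mulmxDl mul_scalar_mx mul_mx_scalar -scalar_mxM.
      by rewrite scalerDl !addrA.
    by rewrite !E; apply/matrixP => i j; rewrite !mxE; field.
  apply: PZ; apply: Plin; apply/Ppsd/h; first exact: rmorphN1.
  exact: conjC1.
move=> A; have -> : A = 2%:R^-1 *: (A + A^!) + (- 'i / 2%:R) *: ('i *: (A - A^!)).
  apply/matrixP => i j; rewrite !mxE.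
  have -> (x : C) : - 'i / 2%:R * ('i * x) = 2%:R^-1 * x.
    transitivity (- ('i ^+ 2) * (2%:R^-1 * x)); first by ring.
    by rewrite sqrCi opprK mul1r.
  by field.
apply: Plin; first by apply: Pherm; rewrite adjmxD adjmxK addrC.
apply: PZ; apply: Pherm; rewrite adjmxZ adjmxB adjmxK conjCi scaleNr -scalerN.
by rewrite opprB.
Qed.

End Psd.

(** * Star-algebras of matrices *)

Section Projections.
Variables (C : numClosedFieldType) (n : nat).
Implicit Types p q : 'M[C]_n.

Definition orthoproj p := p^! = p /\ p *m p = p.

Lemma proj_psd p : orthoproj p -> psdmx p.
Proof. by case=> hp pp; rewrite -pp -{1}hp; exact: psd_adjmul. Qed.

Lemma proj1B p : orthoproj p -> orthoproj (1%:M - p).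
Proof.
case=> hp pp; split; first by rewrite adjmxB adjmx1 hp.
by rewrite mulmxBr mulmx1 mulmxBl mul1mx pp subrr subr0.
Qed.

Lemma row_isometry m (A : 'M[C]_(m, n)) :
  exists V : 'M[C]_(\rank A, n), V *m V^! = 1%:M /\ (V :=: A)%MS.
Proof.
exists (schmidt (row_base A)); split.
  by apply/unitarymx_adjP/schmidt_unitarymx; exact: rank_leq_col.
by apply: eqmx_trans (eq_row_base A); apply/eqmx_schmidt_free/row_base_free.
Qed.

Lemma isometry_sub r m (V : 'M[C]_(r, n)) (A : 'M_(m, n)) :
  V *m V^! = 1%:M -> (A <= V)%MS -> A *m V^! *m V = A.
Proof. by move=> VV /submxP [D ->]; rewrite -[D *m V *m _]mulmxA VV mulmx1. Qed.

Lemma proj_isometry p : orthoproj p ->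
  exists V : 'M[C]_(\rank p, n), V *m V^! = 1%:M /\ V^! *m V = p.
Proof.
case=> hp pp; have [V [VV Vp]] := row_isometry p; exists V; split=> //.
have Vpp : V *m p = V.
  have /submxP [D ->] : (V <= p)%MS by rewrite Vp.
  by rewrite -mulmxA pp.
have pVV : p *m V^! *m V = p by apply: isometry_sub => //; rewrite Vp.
have := congr1 (@adjmx C n n) pVV.
by rewrite !adjmxM adjmxK hp Vpp.
Qed.

Lemma proj_trace p : orthoproj p -> \tr p = (\rank p)%:R.
Proof.
case/proj_isometry => V [VV VE].
by rewrite -[X in \tr X]VE mxtrace_mulC VV mxtrace1.
Qed.

(** The adjoint of [p *m q = q] puts the row space of [q] inside that of [p]; the rank bound makes
    them equal. *)
Lemma proj_rank_eq p q : orthoproj p -> orthoproj q -> p *m q = q ->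
  (\rank p <= \rank q)%N -> p = q.
Proof.
move=> [hp pp] [hq qq] pq rk.
have qp : q *m p = q by rewrite -{1}hq -{1}hp -adjmxM pq hq.
have le_qp : (q <= p)%MS by rewrite -qp submxMl.
have := mxrank_leqif_sup le_qp; rewrite /leqif eqn_leq => -[-> /esym].
by rewrite rk => /submxP [D pE]; rewrite -pq {2}pE -mulmxA qq.
Qed.

End Projections.

Section StarAlgebra.
Variables (C : numClosedFieldType) (n : nat).
Implicit Types (N : 'M[C]_n -> Prop) (A B p q z : 'M[C]_n).

(** Non-unital, so that the ideal annihilated by a central projection is again an instance. *)
Definition star_algebra N :=
  [/\ N 0, forall a A B, N A -> N B -> N (a *: A + B),
      forall A B, N A -> N B -> N (A *m B) & forall A, N A -> N A^!].

Section Theory.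
Variable N : 'M[C]_n -> Prop.
Hypothesis sN : star_algebra N.

Lemma star_algZ a A : N A -> N (a *: A).
Proof. by case: sN => N0 Nl _ _ nA; rewrite -[_ *: _]addr0; apply: Nl. Qed.

Lemma star_algD A B : N A -> N B -> N (A + B).
Proof. by case: sN => N0 Nl _ _ nA nB; rewrite -[A]scale1r; apply: Nl. Qed.

Lemma star_algB A B : N A -> N B -> N (A - B).
Proof. by move=> nA nB; rewrite addrC -scaleN1r; case: sN => _ Nl _ _; apply: Nl. Qed.

Lemma star_algM A B : N A -> N B -> N (A *m B).
Proof. by case: sN => _ _ h _; exact: h. Qed.

Lemma star_alg_adj A : N A -> N A^!.
Proof. by case: sN => _ _ _ h; exact: h. Qed.

Lemma star_alg_sum I (r : seq I) (P : pred I) (F : I -> 'M[C]_n) :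
  (forall i, P i -> N (F i)) -> N (\sum_(i <- r | P i) F i).
Proof.
by move=> h; apply: big_ind => //; [case: sN | exact: star_algD].
Qed.

(* The indicator function of one eigenvalue [c] is a multiple of a polynomial
   vanishing at 0 and at the other eigenvalues. *)
Lemma spectral_projection H : N H -> H^! = H -> H != 0 ->
  exists q c G, [/\ N q, orthoproj q, q != 0, H *m q = c *: q & q = H *m G].
Proof.
move=> NH hH H0; have [P [s [PP PP' HE]]] := herm_spectral hH.
pose f (u : 'rV[C]_n) := P^! *m diag_mx u *m P.
have fM (u v : 'rV[C]_n) : f u *m f v = f (\row_i (u 0 i * v 0 i)).
  rewrite /f -mulmx_diag !mulmxA.
  rewrite -[X in _ = X *m _ *m _](mulmx1 (P^! *m diag_mx u)) -PP.
  by rewrite !mulmxA.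
have fl a (u v : 'rV[C]_n) : f (a *: u + v) = a *: f u + f v.
  by rewrite /f linearP mulmxDr mulmxDl -scalemxAr -scalemxAl.
have [i si0] : exists i, s 0 i != 0.
  apply/existsP; apply: contraNT H0; rewrite negb_exists => /forallP h.
  rewrite HE (_ : s = 0) ?linear0 ?mulmx0 ?mul0mx //.
  by apply/rowP => j; rewrite mxE; apply/eqP; rewrite -[_ == _]negbK h.
set c := s 0 i in si0.
have key (L : seq C) : c \notin L -> exists g : C -> C,
    [/\ g c != 0, g 0 = 0, {in L, forall t, g t = 0} & N (f (\row_j g (s 0 j)))].
  elim: L => [|t L IH] => [_|].
    exists id; split=> //=; have -> : \row_j s 0 j = s by apply/rowP => j; rewrite mxE.
    by rewrite /f -HE.
  rewrite inE negb_or => /andP [ct /IH [g [gc g0 gL Ng]]].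
  exists (fun x => g x * (x - t)); split.
  - by rewrite mulf_neq0 // subr_eq0.
  - by rewrite g0 mul0r.
  - move=> y; rewrite inE => /orP [/eqP->|/gL ->]; rewrite ?subrr ?mulr0 ?mul0r //.
  - have -> : f (\row_j (g (s 0 j) * (s 0 j - t))) =
        f (\row_j g (s 0 j)) *m H + (- t) *: f (\row_j g (s 0 j)).
      rewrite HE -/(f s) fM addrC -fl; congr f; apply/rowP => j; rewrite !mxE.
      by ring.
    by apply: star_algD; [apply: star_algM | apply: star_algZ].
have [|g [gc g0 gL Ng]] := key [seq x <- [seq s 0 j | j <- enum 'I_n] | x != c].
  by rewrite mem_filter eqxx.
pose e : 'rV[C]_n := \row_j (s 0 j == c)%:R.
have qE : f e = (g c)^-1 *: f (\row_j g (s 0 j)).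
  rewrite -[RHS]addr0 (_ : 0 = f 0); last by rewrite /f linear0 mulmx0 mul0mx.
  rewrite -fl; congr f; apply/rowP => j; rewrite !mxE addr0.
  case: eqP => [->|/eqP ne]; first by rewrite mulVf.
  rewrite (gL (s 0 j)) ?mulr0 //=; last first.
    rewrite mem_filter ne; apply/mapP; exists j => //.
    by rewrite mem_enum.
exists (f e), c, (f (c^-1 *: e)); split.
- by rewrite qE; apply: star_algZ.
- split; last by rewrite fM; congr f; apply/rowP => j; rewrite !mxE -natrM mulnb andbb.
  rewrite /f !adjmxM adjmxK adjmx_diag mulmxA; congr (_ *m diag_mx _ *m _).
  by apply/rowP => j; rewrite !mxE conjC_nat.
- apply/eqP => fe0; have : P *m f e *m P^! = 0 by rewrite fe0 mulmx0 mul0mx.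
  rewrite /f !mulmxA PP mul1mx -mulmxA PP mulmx1 => /matrixP/(_ i i)/eqP.
  by rewrite !mxE !eqxx mulr1n oner_eq0.
- rewrite HE -/(f s) fM -[RHS]addr0 (_ : 0 = f 0) -?fl.
    by congr f; apply/rowP => j; rewrite !mxE addr0; case: eqP => [->//|]; rewrite !mulr0.
  by rewrite /f linear0 mulmx0 mul0mx.
- rewrite HE -/(f s) fM; congr f; apply/rowP => j; rewrite !mxE.
  case: eqP => [->|]; last by rewrite !mulr0.
  by rewrite mulr1 divff.
Qed.

(** Rank descent from a spectral projection of [A^! *m A]. The result has least rank among all
    nonzero projections of [N], not only among those below [p]. *)
Lemma minimal_projection A : N A -> A != 0 ->
  exists p, [/\ N p, orthoproj p, p != 0 &
    forall q, N q -> orthoproj q -> q != 0 -> (\rank p <= \rank q)%N].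
Proof.
move=> NA A0.
have [|||p [_ [_ [Np op p0 _ _]]]] := @spectral_projection (A^! *m A).
- by apply: star_algM => //; exact: star_alg_adj.
- by rewrite adjmxM adjmxK.
- by apply: contraNneq A0 => /adjmul_eq0 ->.
have [m le_m] := ubnP (\rank p); elim: m p Np op p0 le_m => // m IH p Np op p0 le_m.
have [[q [Nq oq q0 lt_q]]|none] := classic (exists q, [/\ N q, orthoproj q, q != 0 &
    (\rank q < \rank p)%N]).
  by apply: (IH q) => //; apply: leq_trans lt_q _.
exists p; split=> // q Nq oq q0; rewrite leqNgt; apply/negP => lt_q.
by apply: none; exists q.
Qed.

(** A spectral projection of a Hermitian element of the corner lies below [p], hence equals [p], so
    that element is a multiple of [p]. The general case follows from Hermitian and anti-Hermitian
    parts. *)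
Lemma minimal_corner p : N p -> orthoproj p -> p != 0 ->
  (forall q, N q -> orthoproj q -> q != 0 -> (\rank p <= \rank q)%N) ->
  forall A, N A -> p *m A = A -> A *m p = A -> exists c, A = c *: p.
Proof.
move=> Np op p0 pmin; have [hp pp] := op.
have herm H : N H -> H^! = H -> p *m H = H -> exists c, H = c *: p.
  move=> NH hH pH; have [->|H0] := eqVneq H 0; first by exists 0; rewrite scale0r.
  have [q [c [G [Nq oq q0 Hq qE]]]] := spectral_projection NH hH H0.
  have pq : p *m q = q by rewrite qE mulmxA pH.
  have eq_pq := proj_rank_eq op oq pq (pmin q Nq oq q0).
  exists c; rewrite eq_pq -Hq -eq_pq.
  by rewrite -{1}hH -{1}pH adjmxM hH hp.
move=> A NA pA Ap.
have pA' : p *m A^! = A^! by rewrite -{1}hp -adjmxM Ap.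
have [|||c hc] := herm (A + A^!).
- by apply: star_algD => //; exact: star_alg_adj.
- by rewrite adjmxD adjmxK addrC.
- by rewrite mulmxDr pA pA'.
have [|||e he] := herm ('i *: (A - A^!)).
- by apply/star_algZ/star_algB => //; exact: star_alg_adj.
- by rewrite adjmxZ adjmxB adjmxK conjCi scaleNr -scalerN opprB.
- by rewrite -scalemxAr mulmxBr pA pA'.
exists ((c - 'i * e) / 2%:R).
have -> : A = 2%:R^-1 *: ((A + A^!) - 'i *: ('i *: (A - A^!))).
  rewrite scalerA -expr2 sqrCi scaleN1r opprK addrACA subrr addr0 -mulr2n.
  by rewrite -scaler_nat scalerA mulVf ?pnatr_eq0 // scale1r.
by rewrite hc he scalerA -scalerBl scalerA mulrC.
Qed.

End Theory.
End StarAlgebra.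

(** * Maximal families of partial isometries over a minimal projection *)

Section PartialIsometries.
Variables (C : numClosedFieldType) (n : nat).
Variables (N : 'M[C]_n -> Prop) (p : 'M[C]_n).
Hypotheses (sN : star_algebra N) (Np : N p) (op : orthoproj p) (p0 : p != 0).

(** Partial isometries with common initial projection [p] and pairwise orthogonal ranges; the
    products [u i *m (u j)^!] will be matrix units. *)
Definition isometry_family m (u : 'I_m -> 'M[C]_n) :=
  (forall i, N (u i)) /\ forall i j, (u i)^! *m u j = (i == j)%:R *: p.

Lemma isometry_family_init m (u : 'I_m -> 'M[C]_n) i :
  isometry_family u -> u i *m p = u i.
Proof.
case: op => hp pp [_ uu]; have uui : (u i)^! *m u i = p by rewrite uu eqxx scale1r.
apply/eqP; rewrite -subr_eq0; apply/eqP/adjmul_eq0.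
rewrite adjmxB adjmxM hp mulmxBl !mulmxBr !mulmxA -[p *m _ *m u i]mulmxA uui.
by rewrite !pp !subrr.
Qed.

Lemma isometry_family_proj m (u : 'I_m -> 'M[C]_n) : isometry_family u ->
  orthoproj (\sum_i u i *m (u i)^!).
Proof.
move=> fu; have [_ uu] := fu; split.
  by rewrite adjmx_sum; apply: eq_bigr => i _; rewrite adjmxM adjmxK.
rewrite mulmx_suml; apply: eq_bigr => i _; rewrite mulmx_sumr (bigD1 i) //=.
rewrite big1 ?addr0 => [|j ji]; rewrite mulmxA -[_ *m _ *m u _]mulmxA uu.
  by rewrite eqxx scale1r isometry_family_init.
by rewrite eq_sym (negPf ji) scale0r mulmx0 mul0mx.
Qed.

(** The range projections add up to a projection whose trace, hence rank, is [m] times the rank of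
    [p]. *)
Lemma isometry_family_bound m (u : 'I_m -> 'M[C]_n) :
  isometry_family u -> (m <= n)%N.
Proof.
move=> fu; have := proj_trace (isometry_family_proj fu).
rewrite raddf_sum (eq_bigr (fun=> (\rank p)%:R)) => [|i _]; last first.
  rewrite /= mxtrace_mulC; case: fu => _ ->.
  by rewrite eqxx scale1r proj_trace.
rewrite sumr_const card_ord -mulrnA => /eqP; rewrite eqr_nat => /eqP rk.
apply: leq_trans (rank_leq_col (\sum_i u i *m (u i)^!)).
by rewrite -rk mulnC leq_pmulr // lt0n mxrank_eq0.
Qed.

Hypothesis pmin :
  forall q, N q -> orthoproj q -> q != 0 -> (\rank p <= \rank q)%N.

(** Since [a^! *m a] lies in the corner of [p], it is [c *: p] with [c > 0], and [a] divided by the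
    square root of [c] joins the family. *)
Lemma isometry_family_extend m (u : 'I_m -> 'M[C]_n) a :
  isometry_family u -> N a -> a *m p = a -> (forall i, (u i)^! *m a = 0) ->
  a != 0 -> exists v : 'I_m.+1 -> 'M[C]_n, isometry_family v.
Proof.
move=> fu Na ap ua a0; have [hp pp] := op.
have [|||c cE] := minimal_corner sN Np op p0 pmin (A := a^! *m a).
- by apply: star_algM => //; exact: star_alg_adj.
- by rewrite mulmxA -{1}hp -adjmxM ap.
- by rewrite -mulmxA ap.
have trp : 0 < \tr p by rewrite proj_trace // ltr0n lt0n mxrank_eq0.
have c0 : 0 < c.
  have := adjmul_tr_ge0 a; rewrite cE mxtraceZ pmulr_lge0 // le_eqVlt.
  case/orP => // /eqP ce; case/eqP: a0; apply: adjmul_eq0.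
  by rewrite cE -ce scale0r.
pose b := (sqrtC c)^-1 *: a.
have ub i : (u i)^! *m b = 0 by rewrite -scalemxAr ua scaler0.
have bu i : b^! *m u i = 0 by rewrite -[LHS]adjmxK adjmxM adjmxK ub adjmx0.
have bb : b^! *m b = p.
  rewrite adjmxZ -scalemxAl -scalemxAr scalerA cE scalerA.
  rewrite (CrealP _) ?rpredV ?ger0_real ?sqrtC_ge0 ?ltW //.
  by rewrite -invfM -expr2 sqrtCK mulVf ?scale1r // gt_eqF.
have [Nu uu] := fu.
exists (fun i => if unlift ord_max i is Some j then u j else b); split.
  by move=> i; case: unliftP => [j _|_]; [exact: Nu | exact: star_algZ].
move=> i j; case: unliftP => [i' ->|->]; case: unliftP => [j' ->|->].
- by rewrite uu (inj_eq lift_inj).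
- by rewrite ub eq_sym (negPf (neq_lift _ _)) scale0r.
- by rewrite bu (negPf (neq_lift _ _)) scale0r.
- by rewrite bb eqxx scale1r.
Qed.

(** Extension starts from the one-element family [p] and stops because [m] cannot exceed [n]; [k]
    below is the remaining fuel. *)
Lemma maximal_isometry_family : exists m (u : 'I_m -> 'M[C]_n),
  [/\ (0 < m)%N, isometry_family u &
   forall a, N a -> a *m p = a -> (forall i, (u i)^! *m a = 0) -> a = 0].
Proof.
have step k m (u : 'I_m -> 'M[C]_n) : (0 < m)%N -> isometry_family u ->
    (n < m + k)%N -> exists m' (v : 'I_m' -> 'M[C]_n),
    [/\ (0 < m')%N, isometry_family v &
     forall a, N a -> a *m p = a -> (forall i, (v i)^! *m a = 0) -> a = 0].
  elim: k m u => [|k IH] m u m0 fu lt_n.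
    by move: lt_n; rewrite addn0 ltnNge (isometry_family_bound fu).
  have [[v fv]|none] := classic (exists v : 'I_m.+1 -> 'M[C]_n, isometry_family v).
    by apply: (IH m.+1 v) => //; rewrite addSnnS.
  exists m, u; split=> // a Na ap ua; apply/eqP/negPn/negP => a0.
  by apply: none; exact: isometry_family_extend fu Na ap ua a0.
apply: (step n 1%N (fun=> p)) => //; split=> // i j.
by case: op => hp pp; rewrite !ord1 eqxx hp pp scale1r.
Qed.

End PartialIsometries.

(** * Block matrices in an orthonormal system *)

Section Blocks.
Variables (C : numClosedFieldType) (n : nat) (I : finType) (d1 d2 : I -> nat).
Implicit Types (B : forall k, 'I_(d1 k) -> 'M[C]_(d2 k, n)).
Implicit Types (rho : forall k, 'M[C]_(d2 k)) (x y : forall k, 'M[C]_(d1 k)).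

(** The rows of all the [B k i] together are orthonormal. The blocks are indexed by an arbitrary
    finite type so that an induction can add one through [option]. *)
Definition ortho_blocks B :=
  (forall k i j, B k i *m (B k j)^! = ((i == j)%:R)%:M) /\
  (forall k l i j, k != l -> B k i *m (B l j)^! = 0).

(* The rows of [B k i] are an orthonormal basis of [e_i (x) H_{k,2}] inside
   [H_{k,1} (x) H_{k,2}], so this is [(+)_k x_k (x) rho_k]. *)
Definition blkmx B rho x : 'M[C]_n :=
  \sum_k \sum_i \sum_j x k i j *: ((B k i)^! *m rho k *m B k j).

Lemma eq_blkmx B rho x y : (forall k, x k = y k) ->
  blkmx B rho x = blkmx B rho y.
Proof.
move=> xy; apply: eq_bigr => k _; apply: eq_bigr => i _; apply: eq_bigr => j _.
by rewrite xy.
Qed.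

Section Ortho.
Variable B : forall k, 'I_(d1 k) -> 'M[C]_(d2 k, n).
Arguments B : clear implicits.
Hypothesis oB : ortho_blocks B.

Lemma mul_block_blkmx rho x k i : B k i *m blkmx B rho x =
  \sum_j x k i j *: (rho k *m B k j).
Proof.
case: oB => oBk oBkl.
rewrite mulmx_sumr (bigD1 k) //= [X in _ + X]big1 ?addr0; last first.
  move=> l lk; rewrite mulmx_sumr big1 // => i' _; rewrite mulmx_sumr big1 // => j _.
  by rewrite -scalemxAr !mulmxA oBkl 1?eq_sym // !mul0mx scaler0.
rewrite mulmx_sumr (bigD1 i) //= [X in _ + X]big1 ?addr0; last first.
  move=> i' i'i; rewrite mulmx_sumr big1 // => j _.
  by rewrite -scalemxAr !mulmxA oBk eq_sym (negPf i'i) raddf0 !mul0mx scaler0.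
by rewrite mulmx_sumr; apply: eq_bigr => j _; rewrite -scalemxAr !mulmxA oBk eqxx mul1mx.
Qed.

Lemma blkmx_coord rho x k i j :
  B k i *m blkmx B rho x *m (B k j)^! = x k i j *: rho k.
Proof.
case: oB => oBk _; rewrite mul_block_blkmx mulmx_suml (bigD1 j) //=.
rewrite big1 ?addr0 => [|j' j'j]; rewrite -scalemxAl -mulmxA oBk.
  by rewrite eqxx mulmx1.
by rewrite (negPf j'j) raddf0 mulmx0 scaler0.
Qed.

Lemma blkmxM rho rho' x y :
  blkmx B rho x *m blkmx B rho' y =
  blkmx B (fun k => rho k *m rho' k) (fun k => x k *m y k).
Proof.
rewrite mulmx_suml; apply: eq_bigr => k _; rewrite mulmx_suml; apply: eq_bigr => i _.
rewrite mulmx_suml.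
under eq_bigr => j _.
  rewrite -scalemxAl -mulmxA mul_block_blkmx mulmx_sumr scaler_sumr; over.
rewrite exchange_big /=; apply: eq_bigr => l _; rewrite mxE scaler_suml.
apply: eq_bigr => j _; rewrite -scalemxAr scalerA !mulmxA //.
Qed.

Lemma mxtrace_blkmx rho x : (forall k, \tr (rho k) = 1) ->
  \tr (blkmx B rho x) = \sum_k \tr (x k).
Proof.
case: oB => oBk _ tr1; rewrite raddf_sum; apply: eq_bigr => k _.
rewrite raddf_sum; apply: eq_bigr => i _; rewrite raddf_sum /= (bigD1 i) //=.
rewrite big1 ?addr0 => [|j ji]; rewrite mxtraceZ mxtrace_mulC mulmxA oBk.
  by rewrite eqxx mul1mx tr1 mulr1.
by rewrite (negPf ji) raddf0 mul0mx mxtrace0 mulr0.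
Qed.

End Ortho.

Lemma blkmx_adj B rho x : (forall k, (rho k)^! = rho k) ->
  (blkmx B rho x)^! = blkmx B rho (fun k => (x k)^!).
Proof.
move=> hr; rewrite adjmx_sum; apply: eq_bigr => k _; rewrite adjmx_sum.
under eq_bigr => i _ do rewrite adjmx_sum.
rewrite exchange_big /=; apply: eq_bigr => i _; apply: eq_bigr => j _.
by rewrite adjmxZ !adjmxM adjmxK hr adjmxE mulmxA.
Qed.

End Blocks.

(** * Block decomposition of a star-algebra *)

Section StarAlgebraStructure.
Variables (C : numClosedFieldType) (n : nat).
Implicit Types (N : 'M[C]_n -> Prop) (A p q z : 'M[C]_n).

Lemma big_option (I : finType) (V : nmodType) (F : option I -> V) :
  \sum_k F k = F None + \sum_i F (Some i).
Proof.
rewrite (bigD1 None) //=; congr (_ + _).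
rewrite (reindex_omap (@Some I) id) /=; last by case.
by apply: eq_bigl => i; rewrite eqxx.
Qed.

(* Induction on the rank of the unit [q]: splitting off the ideal generated by
   a minimal projection [p] leaves a smaller algebra with unit [q - z], where
   [z] is the central support of [p]. *)
Lemma star_algebra_blocks_aux m N q : star_algebra N -> orthoproj q ->
  (forall A, N A -> q *m A = A) -> (\rank q < m)%N ->
  exists (I : finType) (d1 d2 : I -> nat)
         (B : forall k, 'I_(d1 k) -> 'M[C]_(d2 k, n)),
  [/\ forall k, (0 < d1 k)%N, forall k, (0 < d2 k)%N, ortho_blocks B,
      forall k i j, N ((B k i)^! *m B k j) &
      forall A, N A -> exists x, A = blkmx B (fun=> 1%:M) x].
Proof.
elim: m N q => // m IH N q sN oq qN lt_q.
have [[A0 [NA0 A00]]|none] := classic (exists A, N A /\ A != 0); last first.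
  exists void, (fun=> 0%N), (fun=> 0%N), (fun k : void => match k with end).
  split; try by case.
    by split; case.
  move=> A NA; exists (fun k : void => match k with end); rewrite /blkmx big1; last by case.
  by apply/eqP/negPn/negP => A0'; apply: none; exists A.
have [p [Np op p0 pmin]] := minimal_projection sN NA0 A00.
have [r [u [r0 fu umax]]] := maximal_isometry_family sN Np op p0 pmin.
have [Nu uu] := fu; have up i := isometry_family_init op i fu.
have oz := isometry_family_proj op fu; set z := \sum_i _ in oz.
have [hz zz] := oz; have [hp pp] := op; have [hq qq] := oq.
have Nz : N z by apply: star_alg_sum => // i _; apply: star_algM => //;
  exact: star_alg_adj.
have zu i : z *m u i = u i.
  rewrite mulmx_suml (bigD1 i) //= big1 ?addr0 => [|j ji].
    by rewrite -mulmxA uu eqxx scale1r up.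
  by rewrite -mulmxA uu (negPf ji) scale0r mulmx0.
have uz i : (u i)^! *m z = (u i)^! by rewrite -{1}hz -adjmxM zu.
(* The difference [A - z *m A] is orthogonal to every range, so maximality of the family kills
   it. *)
have zNp A : N A -> A *m p = A -> z *m A = A.
  move=> NA Ap; apply/eqP; rewrite eq_sym -subr_eq0; apply/eqP/umax.
  - by apply: star_algB => //; exact: star_algM.
  - by rewrite mulmxBl -mulmxA Ap.
  - by move=> i; rewrite mulmxBr mulmxA uz subrr.
have zNz A : N A -> z *m A *m z = A *m z.
  move=> NA; rewrite [in RHS]mulmx_sumr mulmx_sumr; apply: eq_bigr => i _.
  rewrite -mulmxA [A *m _]mulmxA [LHS]mulmxA zNp //; first exact: star_algM.
  by rewrite -mulmxA up.
(* Centrality of [z]: the previous identity for [A^!], after taking adjoints, gives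
   [z *m A *m z = z *m A]. *)
have zC A : N A -> z *m A = A *m z.
  move=> NA; rewrite -(zNz _ NA); apply: adjmx_inj.
  have := zNz _ (star_alg_adj sN NA).
  by rewrite !adjmxM hz mulmxA => ->.
have trp : \tr p != 0 by rewrite proj_trace // pnatr_eq0 mxrank_eq0.
(* Each [(u i)^! *m A *m u j] lies in the corner of [p], so it is a scalar multiple of [p], read off
   by the trace. *)
have zN A : N A -> z *m A = \sum_i \sum_j
    (\tr ((u i)^! *m A *m u j) / \tr p) *: (u i *m (u j)^!).
  move=> NA; rewrite -{1}zz -mulmxA (zC A) // mulmxA.
  rewrite !mulmx_suml; apply: eq_bigr => i _.
  rewrite mulmx_sumr; apply: eq_bigr => j _.
  have [|||c cE] := minimal_corner sN Np op p0 pmin (A := (u i)^! *m A *m u j).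
  - by do !apply: star_algM => //; exact: star_alg_adj.
  - by rewrite !mulmxA -{1}hp -adjmxM up.
  - by rewrite -mulmxA up.
  rewrite cE mxtraceZ mulfK //.
  have -> : u i *m (u i)^! *m A *m (u j *m (u j)^!) =
      u i *m ((u i)^! *m A *m u j) *m (u j)^! by rewrite !mulmxA.
  by rewrite cE -scalemxAr up scalemxAl.
pose N' A := N A /\ z *m A = 0.
have sN' : star_algebra N'.
  split.
  - by split; [case: sN | rewrite mulmx0].
  - move=> a A A' [NA zA] [NA' zA']; split; first by case: sN => _ h _ _; apply: h.
    by rewrite mulmxDr -scalemxAr zA zA' scaler0 addr0.
  - move=> A A' [NA zA] [NA' _]; split; first exact: star_algM.
    by rewrite mulmxA zA mul0mx.
  - move=> A [NA zA]; split; first exact: star_alg_adj.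
    rewrite zC; last exact: star_alg_adj.
    by rewrite -{1}hz -adjmxM zA adjmx0.
have qz := qN _ Nz.
have zq : z *m q = z by rewrite -{1}hz -{1}hq -adjmxM qz hz.
have oq' : orthoproj (q - z).
  split; first by rewrite adjmxB hq hz.
  by rewrite mulmxBl !mulmxBr qq qz zq zz subrr subr0.
have z0 : z != 0.
  apply: contraNneq p0 => z0; have := uu (Ordinal r0) (Ordinal r0).
  by rewrite eqxx scale1r -uz z0 mulmx0 mul0mx => <-.
have lt_q' : (\rank (q - z)%R < m)%N.
  rewrite -ltnS; apply: leq_trans lt_q; rewrite ltnS ltnNge; apply/negP => rk.
  have qE : q = q - z.
    by apply: proj_rank_eq oq oq' _ rk; rewrite mulmxBr qq qz.
  by case/eqP: z0; rewrite -(GRing.subKr q z) -qE subrr.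
have [|I [d1 [d2 [B [d1_gt0 d2_gt0 [oB oB'] NB' N'B]]]]] := IH N' (q - z) sN' oq' _ lt_q'.
  by move=> A [NA zA]; rewrite mulmxBl qN // zA subr0.
have [V [VV VE]] := proj_isometry op.
(* The remaining blocks are annihilated by [z], which fixes each [u j]. *)
have Bu k (i : 'I_(d1 k)) j : B k i *m u j = 0.
  have [_] := NB' k i i; rewrite mulmxA => zBB.
  have : z *m (B k i)^! = 0.
    by rewrite -[LHS]mulmx1 -(_ : B k i *m (B k i)^! = 1%:M) ?mulmxA ?zBB ?mul0mx //
      oB eqxx.
  move=> /(congr1 (@adjmx C _ _)); rewrite adjmxM adjmxK hz adjmx0 => Bz.
  by rewrite -zu mulmxA Bz mul0mx.
pose e1 k := if k is Some k' then d1 k' else r.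
pose e2 k := if k is Some k' then d2 k' else \rank p.
(* [None] is the new block: [V] has orthonormal rows spanning the range of [p], and the [u i]
   transport this frame to their ranges. *)
pose D (k : option I) : 'I_(e1 k) -> 'M[C]_(e2 k, n) :=
  match k with Some k' => B k' | None => fun i => V *m (u i)^! end.
have DD i j : (D None i)^! *m D None j = u i *m (u j)^!.
  by rewrite /D adjmxM adjmxK !mulmxA -[_ *m _ *m V]mulmxA VE up.
exists (option I), e1, e2, D; split.
- by case.
- case=> [k|]; first exact: d2_gt0.
  by rewrite /e2 lt0n mxrank_eq0.
- split.
    case=> [k|] i j; first exact: oB.
    rewrite /D adjmxM adjmxK !mulmxA -[_ *m _ *m u j]mulmxA uu.
    by rewrite -scalemxAr -scalemxAl -{1}VE !mulmxA VV mul1mx VV scalemx1.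
  case=> [k|] [l|] i j //= kl.
  - exact: oB'.
  - by rewrite adjmxM adjmxK mulmxA Bu mul0mx.
  - by rewrite -mulmxA -adjmxM Bu adjmx0 mulmx0.
- case=> [k|] i j; first by case: (NB' k i j).
  by rewrite DD; apply: star_algM => //; exact: star_alg_adj.
- move=> A NA.
  have [|x' xE] := N'B (A - z *m A).
    split; first by apply: star_algB => //; exact: star_algM.
    by rewrite mulmxBr mulmxA zz subrr.
  exists (fun k => match k as k0 return 'M[C]_(e1 k0) with
    | Some k' => x' k'
    | None => \matrix_(i, j) (\tr ((u i)^! *m A *m u j) / \tr p) end).
  rewrite /blkmx big_option -[LHS](subrK (z *m A)) addrC; congr (_ + _) => //.
  rewrite zN //; apply: eq_bigr => i _; apply: eq_bigr => j _.
  by rewrite mxE mulmx1 DD.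
Qed.

Theorem star_algebra_blocks N : star_algebra N -> N 1%:M ->
  exists (K : nat) (d1 d2 : 'I_K -> nat)
         (B : forall k, 'I_(d1 k) -> 'M[C]_(d2 k, n)),
  [/\ (forall k, 0 < d1 k)%N /\ (forall k, 0 < d2 k)%N, ortho_blocks B,
      forall k i j, N ((B k i)^! *m B k j),
      forall A, N A -> exists x, A = blkmx B (fun=> 1%:M) x &
      blkmx B (fun=> 1%:M) (fun=> 1%:M) = 1%:M].
Proof.
move=> sN N1.
have o1 : orthoproj (1%:M : 'M[C]_n) by split; rewrite ?adjmx1 ?mulmx1.
have [I [d1 [d2 [B [d1_gt0 d2_gt0 [oB oB'] NB NE]]]]] :=
  star_algebra_blocks_aux sN o1 (fun A _ => mul1mx A) (ltnSn _).
pose D (k : 'I_#|I|) : 'I_(d1 (enum_val k)) -> 'M[C]_(d2 (enum_val k), n) :=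
  B (enum_val k).
have oD : ortho_blocks D.
  split=> [k i j|k l i j kl]; first exact: oB.
  by apply: oB'; rewrite (inj_eq enum_val_inj).
have ND A : N A -> exists x, A = blkmx D (fun=> 1%:M) x.
  move=> /NE [x ->]; exists (fun k => x (enum_val k)).
  by rewrite /blkmx (reindex _ (onW_bij _ (@enum_val_bij I))).
exists #|I|, (fun k => d1 (enum_val k)), (fun k => d2 (enum_val k)), D.
split=> //; first by move=> k i j; exact: NB.
(* The block identity absorbs the expansion of [1%:M], so it equals [1%:M]: the blocks exhaust the
   space. *)
have [x xE] := ND _ N1; rewrite -[LHS]mulmx1 {1}xE blkmxM // [RHS]xE.
by apply: eq_bigr => k _; apply: eq_bigr => i _; apply: eq_bigr => j _; rewrite !mul1mx.
Qed.

End StarAlgebraStructure.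

(** * Schwarz maps and their peripheral eigenvectors *)

(** Degenerate case of Cauchy-Schwarz: null vectors of a positive semidefinite form lie in its
    kernel. *)
Lemma sesquilinear_kernel (C : numClosedFieldType) (V : lmodType C)
    (h : V -> V -> C) :
  (forall w a u v, h w (a *: u + v) = a * h w u + h w v) ->
  (forall u v, h v u = (h u v)^*) -> (forall u, 0 <= h u u) ->
  forall u v, h u u = 0 -> h v u = 0.
Proof.
move=> hlin hC h0 u v huu; apply/eqP/negPn/negP => nz.
pose x := h v u; have x2 : 0 < `|x| ^+ 2 by rewrite exprn_gt0 // normr_gt0.
(* Chosen so that [t * x = - (h v v + 1)], which makes [h w w] equal to [- (h v v + 2)], a negative
   value. *)
pose s := (h v v + 1) / `|x| ^+ 2.
have s_real : s^* = s.
  apply/CrealP/ger0_real; rewrite divr_ge0 ?addr_ge0 ?h0 //; exact: ltW.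
pose t := - (s * x^*); pose w := t *: u + v.
have tx : t * x = - (h v v + 1).
  by rewrite /t mulNr -mulrA -normCKC /s divfK // gt_eqF.
have wE : h w w = t * x + (t * x)^* + (h v v)^*.
  rewrite {2}/w hlin (hC u w) (hC v w) /w !hlin huu mulr0 add0r -hC -/x.
  by rewrite rmorphD /= addrA.
have := h0 w; rewrite wE tx rmorphN rmorphD rmorph1 /= (CrealP (ger0_real (h0 v))).
have -> : - (h v v + 1) + - (h v v + 1) + h v v = - (h v v + 2%:R) by ring.
by rewrite oppr_ge0 => /(lt_le_trans (ltr_wpDl (h0 v) (ltr0Sn C 1))); rewrite ltxx.
Qed.

(** * The span of the peripheral eigenvectors *)

Section PeripheralSpan.
Variables (C : numClosedFieldType) (n : nat).
Implicit Types (T : 'M[C]_n -> 'M[C]_n) (X Y : 'M[C]_n).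

Lemma in_XT_peripheral T X : peripheral T X -> in_XT T X.
Proof.
by move=> pX; exists 1%N, (fun=> 1), (fun=> X); split=> //; rewrite big_ord1 scale1r.
Qed.

Lemma in_XT0 T : in_XT T 0.
Proof.
by exists 0%N, (fun=> 0), (fun=> 0); split; [case | rewrite big_ord0].
Qed.

Lemma in_XT_lin T a X Y :
  in_XT T X -> in_XT T Y -> in_XT T (a *: X + Y).
Proof.
move=> [m [c [U [pU ->]]]] [m' [c' [U' [pU' ->]]]].
exists (m + m')%N, (fun i => match split i with inl j => a * c j | inr j => c' j end),
  (fun i => match split i with inl j => U j | inr j => U' j end).
split=> [i|]; first by case: split.
rewrite big_split_ord scaler_sumr; congr (_ + _); apply: eq_bigr => i _.
  by rewrite (unsplitK (inl i)) scalerA.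
by rewrite (unsplitK (inr i)).
Qed.

Lemma in_XT_ind T (P : 'M[C]_n -> Prop) : P 0 ->
  (forall a X Y, P X -> P Y -> P (a *: X + Y)) ->
  (forall X, peripheral T X -> P X) -> forall X, in_XT T X -> P X.
Proof.
move=> P0 Plin Pper X [m [c [U [pU ->]]]]; elim/big_rec: _ => // i Y _ PY.
by apply: Plin => //; exact: Pper.
Qed.

Lemma in_XT_sum T I (r : seq I) (P : pred I)
    (F : I -> 'M[C]_n) :
  (forall i, P i -> in_XT T (F i)) -> in_XT T (\sum_(i <- r | P i) F i).
Proof.
move=> h; apply: big_ind => //; first exact: in_XT0.
by move=> X Y hX hY; rewrite -[X]scale1r; apply: in_XT_lin.
Qed.

End PeripheralSpan.

Section Schwarz.
Variables (C : numClosedFieldType) (n : nat) (T E : {linear 'M[C]_n -> 'M[C]_n}).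

(** The conditions are put on the adjoint [E]; Hermiticity, positivity and trace preservation of [T]
    are derived from them. In this form they pass to compressions. *)
Definition schwarz_dual :=
  [/\ is_adjoint_map T E, E 1%:M = 1%:M, forall A, E A^! = (E A)^! &
      forall A, psdmx (E (A^! *m A) - (E A)^! *m E A)].

Hypothesis TE : schwarz_dual.

Lemma dual_adj A B : \tr (A *m E B) = \tr (T A *m B).
Proof. by case: TE. Qed.

Lemma dual_starE A : E A^! = (E A)^!.
Proof. by case: TE. Qed.

Lemma dual_psdE A : psdmx A -> psdmx (E A).
Proof.
case: TE => _ _ _ sch /psd_factor [F ->].
by rewrite -(subrK ((E F)^! *m E F) (E _)); apply: psdD => //; exact: psd_adjmul.
Qed.

Lemma dual_starT A : T A^! = (T A)^!.
Proof.
apply: mxtrace_pairing_inj => X; rewrite mxtrace_mulC -dual_adj.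
rewrite -[X in \tr X]adjmxK mxtrace_adj adjmxM adjmxK -dual_starE mxtrace_mulC dual_adj.
by rewrite -mxtrace_adj adjmxM adjmxK.
Qed.

Lemma dual_psdT A : psdmx A -> psdmx (T A).
Proof.
move=> pA; apply: psd_of_tr; first by rewrite -dual_starT psd_adj.
move=> B pB; rewrite mxtrace_mulC -dual_adj.
by apply: psd_tr_mul_ge0 => //; exact: dual_psdE.
Qed.

Lemma dual_trT A : \tr (T A) = \tr A.
Proof. by have := dual_adj A 1%:M; case: TE => _ -> _ _; rewrite !mulmx1. Qed.

(** The Schwarz defect traced against [s] is a positive semidefinite sesquilinear form, of which [A]
    is a null vector. This is the multiplicative domain argument. *)
Lemma schwarz_defect (s A : 'M[C]_n) : psdmx s ->
  \tr (s *m (E (A^! *m A) - (E A)^! *m E A)) = 0 ->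
  forall B, \tr (s *m (E (B^! *m A) - (E B)^! *m E A)) = 0.
Proof.
move=> ps sA B.
pose h (U V : 'M[C]_n) := \tr (s *m (E (U^! *m V) - (E U)^! *m E V)).
apply: (@sesquilinear_kernel _ _ h) => // [W a U V|U V|U].
- rewrite /h [W^! *m _]mulmxDr -[W^! *m _]scalemxAr !(linearP E) /=.
  rewrite [(E W)^! *m _]mulmxDr -[(E W)^! *m _]scalemxAr.
  rewrite opprD addrACA -scalerBr mulmxDr -scalemxAr.
  by rewrite mxtraceD mxtraceZ.
- rewrite /h -mxtrace_adj adjmxM adjmxB adjmxM adjmxK -!dual_starE adjmxM adjmxK.
  by rewrite (psd_adj ps) mxtrace_mulC.
- by apply: psd_tr_mul_ge0 => //; case: TE.
Qed.

Lemma peripheral_adj X : peripheral T X -> peripheral T X^!.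
Proof.
move=> [l [l1 lX]]; exists l^*; split; first by rewrite norm_conjC.
by rewrite dual_starT lX adjmxZ.
Qed.

End Schwarz.

(** [R] is the modulus of [Y], and [U] is [Y] times the pseudo-inverse of [R], a partial isometry
    whose initial space is the support of [R]. *)
Lemma polar_decomposition (C : numClosedFieldType) n (Y : 'M[C]_n) :
  exists U R : 'M[C]_n,
    [/\ psdmx R, U *m R = Y, U^! *m Y = R, R *m U^! *m U = R & U *m U^! *m U = U].
Proof.
have [R [S [[pR hS] RR SR RSR SRS]]] := psd_sqrt (psd_adjmul Y).
have hR := psd_adj pR.
have UU : (Y *m S)^! *m (Y *m S) = R *m S.
  by rewrite adjmxM hS mulmxA -[S *m _ *m _]mulmxA -RR !mulmxA SR RSR.
exists (Y *m S), R; split=> //.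
- pose D := S *m R - 1%:M.
  have YD : Y *m S *m R - Y = Y *m D by rewrite mulmxBr mulmx1 mulmxA.
  apply/eqP; rewrite -subr_eq0; apply/eqP/adjmul_eq0; rewrite YD adjmxM.
  have -> : D^! *m Y^! *m (Y *m D) = D^! *m (Y^! *m Y) *m D by rewrite !mulmxA.
  have RD : R *m D = 0 by rewrite mulmxBr mulmx1 mulmxA RSR subrr.
  by rewrite -RR -!mulmxA RD !mulmx0.
- by rewrite adjmxM hS -mulmxA -RR mulmxA SR RSR.
- by rewrite -mulmxA UU -SR mulmxA RSR.
- by rewrite -mulmxA UU -mulmxA (mulmxA S) SRS.
Qed.

Section PeripheralFixedPoint.
Variables (C : numClosedFieldType) (n : nat) (T E : {linear 'M[C]_n -> 'M[C]_n}).
Hypothesis TE : schwarz_dual T E.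

(* With [Y = U R] polar and [s = U R U^! = |Y^!|], the chain
   [\tr R = \tr (l^* E(U^!) Y) <= \tr (s E(U^!)^! E(U^!)) <= \tr (s E(U U^!)) <= \tr s]
   is an equality, so the Schwarz defect of [U^!] vanishes on [s]. *)
Lemma peripheral_fixed_point Y : peripheral T Y ->
  exists s, [/\ psdmx s, T s = s & (Y^! <= s)%MS].
Proof.
move=> pY; have [l [l1 TY]] := pY.
have ll : l^* * l = 1 by rewrite -normCKC l1 expr1n.
have [U [R [pR UR UY RUU UUU]]] := polar_decomposition Y.
have hR := psd_adj pR; pose s := U *m R *m U^!.
have ps : psdmx s by exact: psd_congr.
have trs : \tr s = \tr R by rewrite /s mxtrace_mulC mulmxA mxtrace_mulC mulmxA RUU.
have RU : R *m U^! = Y^! by rewrite -UR adjmxM hR.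
have oU : orthoproj (U *m U^!).
  by split; rewrite ?adjmxM ?adjmxK // mulmxA UUU.
pose B := l^* *: E U^!.
have EB : E U^! = l *: B by rewrite scalerA mulrC ll scale1r.
have EEB : (E U^!)^! *m E U^! = B^! *m B.
  by rewrite EB adjmxZ -scalemxAl -scalemxAr scalerA ll scale1r.
have trBY : \tr (B *m Y) = \tr R.
  rewrite -scalemxAl mxtraceZ mxtrace_mulC (dual_adj TE) TY -scalemxAl mxtraceZ.
  by rewrite mulrA ll mul1r mxtrace_mulC UY.
have trR : (\tr R)^* = \tr R by rewrite -mxtrace_adj hR.
(* [W] measures the gap in the Cauchy-Schwarz step of the chain. *)
pose W := B *m U - 1%:M.
have WE : \tr (W *m R *m W^!) = \tr (s *m (B^! *m B)) - \tr R.
  have -> : W *m R = B *m Y - R by rewrite mulmxBl mul1mx -mulmxA UR.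
  rewrite adjmxB adjmxM adjmx1 mulmxBr mulmx1 !mulmxBl !linearB /= trBY subrr subr0.
  have -> : \tr (R *m (U^! *m B^!)) = \tr R.
    by rewrite -{1}[R]hR -!adjmxM mxtrace_adj -mulmxA UR trBY trR.
  by rewrite -UR [s *m _]mulmxA [in RHS]mxtrace_mulC !mulmxA.
have pEUU : psdmx (1%:M - E (U *m U^!)).
  have [_ <- _ _] := TE; rewrite -linearB; apply: (dual_psdE TE).
  exact/proj_psd/proj1B.
have sch : psdmx (E (U *m U^!) - (E U^!)^! *m E U^!).
  by have [_ _ _ /(_ U^!)] := TE; rewrite adjmxK.
have h1 : 0 <= \tr (W *m R *m W^!) by apply/psd_tr_ge0/psd_congr.
have h2 : 0 <= \tr (s *m (E (U *m U^!) - (E U^!)^! *m E U^!)) by exact: psd_tr_mul_ge0.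
have h3 : 0 <= \tr (s *m (1%:M - E (U *m U^!))) by exact: psd_tr_mul_ge0.
(* The three nonnegative gaps of the chain telescope to [\tr s - \tr R = 0], so each vanishes. *)
have sum0 : \tr (W *m R *m W^!) + \tr (s *m (E (U *m U^!) - (E U^!)^! *m E U^!))
   + \tr (s *m (1%:M - E (U *m U^!))) = 0.
  rewrite WE EEB !mulmxBr mulmx1 !linearB /= trs; ring.
move: sum0 => /eqP; rewrite paddr_eq0 ?addr_ge0 // paddr_eq0 //.
case/andP => /andP [/eqP e1 /eqP e2] _.
have BY : B *m Y = R.
  have := psd_congr_eq0 pR (psd_tr_eq0 (psd_congr W pR) e1).
  by rewrite /W mulmxBl mul1mx -mulmxA UR => /eqP; rewrite subr_eq0 => /eqP.
have Es : E U^! *m s = l *: Y^!.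
  by rewrite EB -scalemxAl /s -RU UR mulmxA BY.
(* The vanishing defect makes [E] multiplicative against [U^!] under [s]; the trace pairing turns
   this into a statement on [T s]. *)
have UTs : U^! *m T s = Y^!.
  apply: mxtrace_pairing_inj => X.
  have := @schwarz_defect _ _ _ _ TE s U^! ps; rewrite adjmxK => /(_ e2 X^!).
  rewrite adjmxK mulmxBr linearB /= => /eqP; rewrite subr_eq0 => /eqP.
  rewrite (dual_adj TE) -(dual_starE TE) adjmxK => key.
  rewrite mulmxA mxtrace_mulC key mulmxA mxtrace_mulC mulmxA Es.
  rewrite -scalemxAl mxtraceZ (dual_adj TE) (dual_starT TE) TY adjmxZ -scalemxAl.
  by rewrite mxtraceZ mulrA [l * _]mulrC ll mul1r mxtrace_mulC.
have UUT : U *m U^! *m T s = s by rewrite -mulmxA UTs -RU mulmxA.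
exists s; split=> //.
  (* By trace preservation the part of [T s] outside the range of [U] has trace zero, hence
     vanishes. *)
  have := psd_tr_mul_eq0 (proj_psd (proj1B oU)) (dual_psdT TE ps).
  rewrite mulmxBl mul1mx UUT linearB /= (dual_trT TE) subrr => /(_ erefl)/eqP.
  by rewrite subr_eq0 => /eqP.
have -> : Y^! = U^! *m s.
  have UUR : U^! *m U *m R = R.
    by apply: adjmx_inj; rewrite !adjmxM adjmxK hR mulmxA RUU.
  by rewrite /s -RU !mulmxA UUR.
exact: submxMl.
Qed.

(** On the kernel of [r + s] the two positive compressions add up to zero, so [r] vanishes there. *)
Lemma psd_sub_add (r s : 'M[C]_n) : psdmx r -> psdmx s -> (r <= (r + s)%R)%MS.
Proof.
move=> pr ps; rewrite submxE; apply/eqP; set K := cokermx _.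
have rsK : K^! *m r *m K + K^! *m s *m K = 0.
  by rewrite -mulmxDl -mulmxDr -mulmxA /K mulmx_coker mulmx0.
have psdK (t : 'M_n) : psdmx t -> psdmx (K^! *m t *m K).
  by move=> pt; rewrite -[X in _ *m X](adjmxK K); exact: psd_congr.
have trK : \tr (K^! *m r *m K) = 0.
  have := congr1 mxtrace rsK; rewrite linearD linear0 /= => /eqP.
  by rewrite (paddr_eq0 (psd_tr_ge0 (psdK _ pr)) (psd_tr_ge0 (psdK _ ps))) => /andP [/eqP].
have := psd_congr_eq0 (B := K^!) pr; rewrite adjmxK.
move=> /(_ (psd_tr_eq0 (psdK _ pr) trK)) /(congr1 (@adjmx C _ _)).
by rewrite adjmxM adjmxK (psd_adj pr) adjmx0.
Qed.

(** Adding a fixed point whose support is not yet covered strictly raises the rank, which is at most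
    [n]. *)
Lemma maximal_fixed_point : exists r,
  [/\ psdmx r, T r = r & forall s, psdmx s -> T s = s -> (s <= r)%MS].
Proof.
have step k r : psdmx r -> T r = r -> (n < \rank r + k)%N -> exists r,
    [/\ psdmx r, T r = r & forall s, psdmx s -> T s = s -> (s <= r)%MS].
  elim: k r => [|k IH] r pr Tr lt_n.
    by move: lt_n; rewrite addn0 ltnNge rank_leq_col.
  have [[s [ps Ts nle]]|none] :=
      classic (exists s, [/\ psdmx s, T s = s & ~~ (s <= r)%MS]).
    apply: (IH (r + s)); [exact: psdD | by rewrite linearD Tr Ts |].
    apply: leq_trans lt_n _; rewrite addnS -addSn leq_add2r ltnNge.
    apply: contra nle => rk; apply: submx_trans (_ : (s <= (r + s)%R)%MS) _.
      by rewrite addrC psd_sub_add.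
    have := mxrank_leqif_sup (psd_sub_add pr ps); rewrite /leqif eqn_leq rk andbT.
    by case=> -> <-.
  exists r; split=> // s ps Ts; apply/negPn/negP => nle.
  by apply: none; exists s.
by apply: (step n.+1 0); rewrite ?linear0 ?mxrank0 //; exact: psd0.
Qed.

End PeripheralFixedPoint.

(** * Compression to the support of a maximal fixed point *)

Section Compression.
Variables (C : numClosedFieldType) (r n : nat) (V : 'M[C]_(r, n)).

Definition compression (F : 'M[C]_n -> 'M[C]_n) (X : 'M[C]_r) : 'M[C]_r :=
  V *m F (V^! *m X *m V) *m V^!.

Lemma compression_linear (F : {linear 'M[C]_n -> 'M[C]_n}) : linear (compression F).
Proof.
move=> a X Y; rewrite /compression mulmxDr mulmxDl -scalemxAr -scalemxAl linearP /=.
by rewrite mulmxDr mulmxDl -scalemxAr -scalemxAl.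
Qed.

HB.instance Definition _ (F : {linear 'M[C]_n -> 'M[C]_n}) :=
  GRing.isLinear.Build C 'M[C]_r 'M[C]_r _ (compression F) (compression_linear F).

End Compression.

Section SupportReduction.
Variables (C : numClosedFieldType) (n : nat) (T E : {linear 'M[C]_n -> 'M[C]_n}).
Hypothesis TE : schwarz_dual T E.

Theorem support_reduction : exists r (V : 'M[C]_(r, n)) (s : 'M[C]_r),
  [/\ V *m V^! = 1%:M, schwarz_dual (compression V T) (compression V E),
      pdmx s /\ compression V T s = s,
      forall X, T (V^! *m X *m V) = V^! *m compression V T X *m V &
      forall X, in_XT T X <->
        exists2 X', in_XT (compression V T) X' & X = V^! *m X' *m V].
Proof.
have [s [ps Ts smax]] := maximal_fixed_point T.
have hs := psd_adj ps.
have [V [VV Vs]] := row_isometry s.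
have subV (A : 'M_n) : (A <= s)%MS -> A *m V^! *m V = A.
  by move=> As; apply: isometry_sub => //; rewrite Vs.
have [D VE] : exists D, V = D *m s.
  apply/submxP; by rewrite Vs.
have hVV : (V^! *m V)^! = V^! *m V by rewrite adjmxM adjmxK.
have oVV : orthoproj (V^! *m V).
  by split=> //; rewrite mulmxA -[_ *m V *m _]mulmxA VV mulmx1.
have sVV := subV s (submx_refl s).
pose Q : 'M[C]_n := 1%:M - V^! *m V.
(* Invariance of the support in dual form: [\tr (s *m E Q) = \tr (T s *m Q) = 0] with both factors
   positive. *)
have VEQ : V *m E Q = 0.
  rewrite VE -mulmxA psd_tr_mul_eq0 ?mulmx0 //.
    exact/(dual_psdE TE)/proj_psd/proj1B.
  by rewrite (dual_adj TE) Ts mulmxBr mulmx1 mulmxA sVV subrr mxtrace0.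
have E1 : E 1%:M = 1%:M by case: TE.
have TV X : T (V^! *m X *m V) *m V^! *m V = T (V^! *m X *m V).
  elim/psd_span_ind: X => [a A B IA IB|A pA].
    rewrite mulmxDr mulmxDl -scalemxAr -scalemxAl linearP /=.
    by rewrite !mulmxDl -!scalemxAl IA IB.
  have pVA : psdmx (V^! *m A *m V) by rewrite -[X in _ *m X]adjmxK; exact: psd_congr.
  have := psd_tr_mul_eq0 (dual_psdT TE pVA) (proj_psd (proj1B oVV)).
  rewrite -(dual_adj TE) -mulmxA VEQ !mulmx0 mxtrace0 mulmxBr mulmx1 mulmxA.
  by move=> /(_ erefl) /eqP; rewrite subr_eq0 => /eqP.
have VT X : V^! *m V *m T (V^! *m X *m V) = T (V^! *m X *m V).
  apply: adjmx_inj; rewrite adjmxM hVV -(dual_starT TE) !adjmxM adjmxK.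
  by rewrite !mulmxA TV.
have TVV X : T (V^! *m X *m V) = V^! *m compression V T X *m V.
  by rewrite /compression !mulmxA VT TV.
exists (\rank s), V, (V *m s *m V^!); split=> //.
- split.
  + move=> A B; rewrite /compression mulmxA mxtrace_mulC !mulmxA (dual_adj TE).
    by rewrite !mulmxA mxtrace_mulC !mulmxA.
  + rewrite /= /compression mulmx1 -(subKr 1%:M (V^! *m V)) -/Q linearB /= E1.
    by rewrite mulmxBr VEQ subr0 mulmx1.
  + move=> A; rewrite /compression !adjmxM !adjmxK -(dual_starE TE) !adjmxM !adjmxK.
    by rewrite !mulmxA.
  + move=> A; pose W := V^! *m A *m V.
    have WW : V^! *m (A^! *m A) *m V = W^! *m W.
      rewrite /W !adjmxM adjmxK !mulmxA -[_ *m V *m V^!]mulmxA VV mulmx1 //.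
    (* Compressing the two factors separately inserts [V^! *m V] between them; the discrepancy is a
       congruence of the projection [Q], hence positive. *)
    have -> : compression V E (A^! *m A) - (compression V E A)^! *m compression V E A =
       V *m (E (W^! *m W) - (E W)^! *m E W) *m V^! +
       (V *m (E W)^!) *m Q *m (V *m (E W)^!)^!.
      rewrite /= /compression WW -/W !adjmxM !adjmxK mulmxBr mulmxBl.
      rewrite /Q mulmxBr mulmx1 !mulmxBl !mulmxA addrA subrK //.
    apply: psdD; apply: psd_congr; last exact/proj_psd/proj1B.
    by case: TE.
- split.
    split; first by case: (psd_congr V ps).
    move=> v v0; have := proj2 (psd_congr V ps) v; rewrite le_eqVlt => /orP[/eqP e|//].
    case/eqP: v0; rewrite -[v]mulmx1 -VV.
    have := psd_congr_eq0 (B := v *m V) ps.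
    have -> : v *m V *m s *m (v *m V)^! = 0.
      have -> : v *m V *m s *m (v *m V)^! = v *m (V *m s *m V^!) *m v^!.
        by rewrite adjmxM !mulmxA.
      by apply/matrixP => i j; rewrite !ord1 -e mxE.
    move=> /(_ erefl) vVs; rewrite mulmxA {2}VE adjmxM hs mulmxA vVs mul0mx //.
  rewrite /= /compression.
  have -> : V^! *m (V *m s *m V^!) *m V = (V^! *m V) *m (s *m V^! *m V).
    by rewrite !mulmxA.
  by rewrite sVV -[_ *m s]adjmxK adjmxM hVV hs mulmxA sVV hs Ts.
- move=> X; split.
  + move: X; apply: in_XT_ind => [|a X Y [X' hX ->] [Y' hY ->]|X pX].
    * by exists 0; [exact: in_XT0 | rewrite mulmx0 mul0mx].
    * exists (a *: X' + Y'); first exact: in_XT_lin.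
      by rewrite mulmxDr mulmxDl -scalemxAr -scalemxAl.
    (* The fixed point attached to [Y] has its support below that of [s], by maximality. *)
    * have VX Y : peripheral T Y -> V^! *m V *m Y = Y.
        move=> /(peripheral_fixed_point TE) [t [pt Tt Yt]].
        apply: adjmx_inj; rewrite adjmxM hVV mulmxA; apply: subV.
        exact: submx_trans Yt (smax t pt Tt).
      have XE : X = V^! *m (V *m X *m V^!) *m V.
        rewrite !mulmxA (VX _ pX) -mulmxA; apply: adjmx_inj.
        by rewrite adjmxM hVV VX //; exact: (peripheral_adj TE).
      exists (V *m X *m V^!) => //; apply: in_XT_peripheral.
      have [l [l1 TX]] := pX; exists l; split=> //.
      by rewrite /compression -XE TX -scalemxAr -scalemxAl.
  + move=> [X' hX' ->]; move: X' hX'; apply: in_XT_ind => [|a A B IA IB|A [l [l1 TA]]].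
    * by rewrite mulmx0 mul0mx; exact: in_XT0.
    * by rewrite mulmxDr mulmxDl -scalemxAr -scalemxAl; exact: in_XT_lin.
    * apply: in_XT_peripheral; exists l; split=> //.
      by rewrite TVV TA -scalemxAr -scalemxAl.
Qed.

End SupportReduction.

(** * Schwarz maps with a faithful fixed point *)

Lemma pd_psd (C : numClosedFieldType) n (A : 'M[C]_n) : pdmx A -> psdmx A.
Proof.
case=> hA pA; split=> // v; have [->|v0] := eqVneq v 0; last exact/ltW/pA.
by rewrite !mul0mx mxE.
Qed.

Lemma pd_mul_eq0 (C : numClosedFieldType) m n (B : 'M[C]_(m, n)) (A : 'M_n) :
  pdmx A -> B *m A = 0 -> B = 0.
Proof.
case=> _ pA BA; apply/row_matrixP => i; rewrite row0; apply/eqP/negPn/negP => /pA.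
by rewrite -row_mul BA row0 mul0mx mxE ltxx.
Qed.

Lemma pd_unit (C : numClosedFieldType) n (A : 'M[C]_n) : pdmx A -> A \in unitmx.
Proof.
move=> pA; rewrite -row_free_unit -kermx_eq0; apply/eqP.
by apply: (pd_mul_eq0 pA); exact: mulmx_ker.
Qed.

Section Faithful.
Variables (C : numClosedFieldType) (n : nat) (T E : {linear 'M[C]_n -> 'M[C]_n}).
Variable s : 'M[C]_n.
Hypotheses (TE : schwarz_dual T E) (pds : pdmx s) (Ts : T s = s).
Let ps := pd_psd pds.
Let hs := psd_adj ps.

Lemma unit_modulus_conj (l : C) : `|l| = 1 -> l^* * l = 1.
Proof. by move=> l1; rewrite -normCKC l1 expr1n. Qed.

Lemma fixed_tr_E A : \tr (s *m E A) = \tr (s *m A).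
Proof. by rewrite (dual_adj TE) Ts. Qed.

(** As [s] is fixed and the eigenvalue unimodular, the defect of [A] has zero trace against [s], so
    it vanishes by faithfulness; [schwarz_defect] then applies to every positive [X]. *)
Lemma peripheral_mulE A B : peripheral E A -> E (B *m A) = E B *m E A.
Proof.
move=> [l [l1 EA]]; have ll := unit_modulus_conj l1.
have D0 : E (A^! *m A) - (E A)^! *m E A = 0.
  apply: (pd_mul_eq0 (B := E (A^! *m A) - (E A)^! *m E A) pds).
  have pD : psdmx (E (A^! *m A) - (E A)^! *m E A) by case: TE.
  apply: psd_tr_mul_eq0 => //; rewrite mxtrace_mulC mulmxBr linearB /= fixed_tr_E.
  by rewrite EA adjmxZ -scalemxAl -!scalemxAr !scalerA ll scale1r subrr.
apply/eqP; rewrite -subr_eq0; apply/eqP/mxtrace_pairing_inj => X.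
rewrite mulmx0 mxtrace0; elim/psd_span_ind: X => [a X Y IX IY|X pX].
  by rewrite mulmxDl -scalemxAl linearD linearZ /= IX IY mulr0 addr0.
have := schwarz_defect TE pX (A := A); rewrite D0 mulmx0 mxtrace0.
by move=> /(_ erefl B^!); rewrite -(dual_starE TE) adjmxK.
Qed.

Lemma in_XT_mulE A B : in_XT E A -> E (B *m A) = E B *m E A.
Proof.
move: A; apply: in_XT_ind => [|a X Y IX IY|A pA]; last exact: peripheral_mulE.
  by rewrite mulmx0 linear0 mulmx0.
by rewrite mulmxDr -scalemxAr !(linearP E) /= IX IY mulmxDr -scalemxAr.
Qed.

Lemma in_XT_starE A : in_XT E A -> in_XT E A^!.
Proof.
move: A; apply: in_XT_ind => [|a X Y IX IY|A [l [l1 EA]]].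
- by rewrite adjmx0; exact: in_XT0.
- by rewrite adjmxD adjmxZ; exact: in_XT_lin.
- apply: in_XT_peripheral; exists l^*; rewrite norm_conjC l1.
  by rewrite (dual_starE TE) EA adjmxZ.
Qed.

Lemma peripheral_star_algebra : star_algebra (in_XT E).
Proof.
split; [exact: in_XT0 | exact: in_XT_lin | | exact: in_XT_starE].
move=> A B NA NB; move: A NA; apply: in_XT_ind => [|a X Y IX IY|A pA].
- by rewrite mul0mx; exact: in_XT0.
- by rewrite mulmxDl -scalemxAl; exact: in_XT_lin.
move: B NB; apply: in_XT_ind => [|a X Y IX IY|B pB].
- by rewrite mulmx0; exact: in_XT0.
- by rewrite mulmxDr -scalemxAr; exact: in_XT_lin.
apply: in_XT_peripheral; rewrite /peripheral peripheral_mulE //.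
have [l [l1 ->]] := pA; have [m [m1 ->]] := pB.
exists (l * m); rewrite normrM l1 m1 mulr1; split=> //.
by rewrite -scalemxAl -scalemxAr scalerA.
Qed.

Lemma in_XT_E1 : in_XT E 1%:M.
Proof.
apply: in_XT_peripheral; exists 1; rewrite normr1 scale1r.
by case: TE => _ -> _ _.
Qed.

(** Multiplicativity of [E] at [A], transposed through the trace pairing. *)
Lemma mulT_E A X : in_XT E A -> T (E A *m X) = A *m T X.
Proof.
move=> NA; apply: mxtrace_pairing_inj => B; rewrite mxtrace_mulC -(dual_adj TE).
rewrite -mulmxA mxtrace_mulC -mulmxA -in_XT_mulE // (dual_adj TE).
by rewrite mxtrace_mulC mulmxA.
Qed.

(* For the inner product [\tr (s A^! B)], [E] is a contraction and [Y s^-1] is an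
   eigenvector of its adjoint for the unimodular eigenvalue [l]. *)
Lemma peripheral_T_E Y l : `|l| = 1 -> T Y = l *: Y ->
  E (Y *m invmx s) = l^* *: (Y *m invmx s).
Proof.
move=> l1 TY; have ll := unit_modulus_conj l1.
move: (mulmxKV (pd_unit pds) Y); move: (Y *m invmx s) => A As.
pose D := E A - l^* *: A.
have TsA : T (s *m A^!) = l^* *: (s *m A^!).
  by rewrite -{1 2}hs -!adjmxM As (dual_starT TE) TY adjmxZ.
(* Expanding the square, the cross terms are evaluated by the eigenvector relation; a nonnegative
   number equals a nonpositive one. *)
have key : \tr (s *m (D^! *m D)) =
    - \tr (s *m (E (A^! *m A) - (E A)^! *m E A)).
  have e1 : \tr (s *m (A^! *m E A)) = l^* * \tr (s *m (A^! *m A)).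
    by rewrite !mulmxA (dual_adj TE) TsA -scalemxAl mxtraceZ.
  have e2 : \tr (s *m ((E A)^! *m A)) = l * \tr (s *m (A^! *m A)).
    have -> : \tr (s *m ((E A)^! *m A)) = (\tr (s *m (A^! *m E A)))^*.
      by rewrite -mxtrace_adj !adjmxM adjmxK hs [RHS]mxtrace_mulC.
    rewrite e1 rmorphM /= conjCK; congr (_ * _).
    by rewrite -mxtrace_adj !adjmxM adjmxK hs [LHS]mxtrace_mulC.
  rewrite /D adjmxB adjmxZ conjCK mulmxBl !mulmxBr -!scalemxAl -!scalemxAr.
  rewrite !scalerA !linearB !linearZ /= e1 e2 fixed_tr_E.
  rewrite !mulrA [l * l^*]mulrC ll !mul1r; ring.
have : \tr (s *m (D^! *m D)) = 0.
  apply/le_anti/andP; split.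
    rewrite key oppr_le0; apply: psd_tr_mul_ge0 => //; by case: TE.
  by apply: psd_tr_mul_ge0 => //; exact: psd_adjmul.
move=> /(psd_tr_mul_eq0 ps (psd_adjmul D)) sDD.
have /eqP : D = 0.
  apply: adjmul_eq0; apply: (pd_mul_eq0 pds); apply: adjmx_inj.
  by rewrite !adjmxM adjmxK hs sDD adjmx0.
by rewrite subr_eq0 => /eqP.
Qed.

Lemma peripheral_E_T A : peripheral E A -> in_XT T (A *m s).
Proof.
move=> [l [l1 EA]]; apply: in_XT_peripheral; exists l^*; rewrite norm_conjC l1.
split=> //; rewrite -[s in RHS]Ts -mulT_E; last first.
  by apply: in_XT_peripheral; exists l.
by rewrite EA -scalemxAl linearZ /= scalerA unit_modulus_conj // scale1r.
Qed.

Lemma in_XT_T_E X : in_XT T X <-> in_XT E (X *m invmx s).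
Proof.
have su := pd_unit pds; split.
  move: X; apply: in_XT_ind => [|a X Y IX IY|Y [l [l1 TY]]].
  - by rewrite mul0mx; exact: in_XT0.
  - by rewrite mulmxDl -scalemxAl; exact: in_XT_lin.
  - apply: in_XT_peripheral; exists l^*; rewrite norm_conjC l1; split=> //.
    exact: peripheral_T_E.
rewrite -{2}(mulmxKV su X); move: (X *m invmx s); apply: in_XT_ind => [|a A B IA IB|A pA].
- by rewrite mul0mx; exact: in_XT0.
- by rewrite mulmxDl -scalemxAl; exact: in_XT_lin.
- exact: peripheral_E_T.
Qed.

Lemma in_XT_mull A X : in_XT E A -> in_XT T X -> in_XT T (A *m X).
Proof.
rewrite !in_XT_T_E => NA NX; rewrite -mulmxA.
exact: (star_algM peripheral_star_algebra).
Qed.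

Lemma in_XT_adjT X : in_XT T X -> in_XT T X^!.
Proof.
move: X; apply: in_XT_ind => [|a X Y IX IY|A pA].
- by rewrite adjmx0; exact: in_XT0.
- by rewrite adjmxD adjmxZ; exact: in_XT_lin.
- exact/in_XT_peripheral/(peripheral_adj TE).
Qed.

(** The description of [in_XT T] as [in_XT E] times [s] shows only a left module; stability under
    adjoints gives the right action. *)
Lemma in_XT_mulr A X : in_XT E A -> in_XT T X -> in_XT T (X *m A).
Proof.
move=> NA NX; rewrite -[_ *m _]adjmxK adjmxM; apply/in_XT_adjT/in_XT_mull.
  exact: in_XT_starE.
exact: in_XT_adjT.
Qed.

Lemma in_XT_fixed : in_XT T s.
Proof. by apply: in_XT_peripheral; exists 1; rewrite normr1 scale1r. Qed.

(** Writing [X = A *m s] and testing with [A^!] gives [\tr (A *m s *m A^!) = 0]. *)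
Lemma in_XT_pairing X : in_XT T X ->
  (forall A, in_XT E A -> \tr (X *m A) = 0) -> X = 0.
Proof.
move=> /in_XT_T_E; set A := X *m _ => NA tr0.
have XE : X = A *m s by rewrite mulmxKV // pd_unit.
have := tr0 A^! (in_XT_starE NA); rewrite {1}XE.
move=> /(psd_tr_eq0 (psd_congr A ps)) /(psd_congr_eq0 ps) <-.
exact: XE.
Qed.

Lemma in_XT_T X : in_XT T X -> in_XT T (T X).
Proof.
move: X; apply: in_XT_ind => [|a X Y IX IY|X [l [l1 TX]]].
- by rewrite linear0; exact: in_XT0.
- by rewrite linearP; exact: in_XT_lin.
- apply: in_XT_peripheral; exists l; split=> //.
  by rewrite {1}TX linearZ.
Qed.

(* Inverts [E] on [in_XT E]: see [dual_invK]. *)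
Definition dual_inv A := T (A *m s) *m invmx s.

Lemma dual_inv_peripheral A l : `|l| = 1 -> E A = l *: A -> dual_inv A = l^* *: A.
Proof.
move=> l1 EA; have NA : in_XT E A by apply: in_XT_peripheral; exists l.
have AE : A *m s = l^* *: (E A *m s).
  by rewrite EA -scalemxAl scalerA unit_modulus_conj // scale1r.
by rewrite /dual_inv AE linearZ /= mulT_E // Ts -scalemxAl mulmxK ?pd_unit.
Qed.

Lemma dual_inv_linear : linear dual_inv.
Proof.
by move=> a X Y; rewrite /dual_inv mulmxDl -scalemxAl linearP mulmxDl -scalemxAl.
Qed.

HB.instance Definition _ := GRing.isLinear.Build C 'M[C]_n 'M[C]_n _ dual_inv dual_inv_linear.

Lemma dual_invK A : in_XT E A -> E (dual_inv A) = A.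
Proof.
move: A; apply: in_XT_ind => [|a X Y IX IY|A [l [l1 EA]]].
- by rewrite !linear0.
- by rewrite !linearP /= IX IY.
- by rewrite (dual_inv_peripheral l1 EA) linearZ /= EA scalerA unit_modulus_conj // scale1r.
Qed.

Lemma dual_inv_in A : in_XT E A -> in_XT E (dual_inv A).
Proof.
move: A; apply: in_XT_ind => [|a X Y IX IY|A [l [l1 EA]]].
- by rewrite linear0; exact: in_XT0.
- by rewrite linearP; exact: in_XT_lin.
- apply: in_XT_peripheral; exists l; split=> //.
  by rewrite (dual_inv_peripheral l1 EA) linearZ /= EA !scalerA mulrC.
Qed.

(** By invariance and multiplicativity, [\tr (s *m (A^! *m A))] equals
    [\tr (s *m (E A^! *m E A)) = 0], and [s] is faithful. *)
Lemma E_inj A : in_XT E A -> E A = 0 -> A = 0.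
Proof.
move=> NA EA; apply: adjmul_eq0; apply: (pd_mul_eq0 pds); apply: adjmx_inj.
rewrite !adjmxM adjmxK hs adjmx0; apply: psd_tr_mul_eq0 => //.
  exact: psd_adjmul.
by rewrite -fixed_tr_E in_XT_mulE // EA mulmx0 mulmx0 mxtrace0.
Qed.

Lemma dual_inv_surj A : in_XT E A -> exists2 A', in_XT E A' & dual_inv A' = A.
Proof.
move=> NA; have NE : in_XT E (E A).
  move: A NA; apply: in_XT_ind => [|a X Y IX IY|A [l [l1 EA]]].
  - by rewrite linear0; exact: in_XT0.
  - by rewrite linearP; exact: in_XT_lin.
  - by apply: in_XT_peripheral; exists l; rewrite {1}EA linearZ.
exists (E A) => //; apply/eqP; rewrite -subr_eq0; apply/eqP/E_inj.
  by apply: (star_algB peripheral_star_algebra) => //; exact: dual_inv_in.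
by rewrite linearB /= dual_invK // subrr.
Qed.

(** Both sides have the same image under [E], which is multiplicative and injective on the
    algebra. *)
Lemma dual_inv_mul A B : in_XT E A -> in_XT E B -> dual_inv (A *m B) = dual_inv A *m dual_inv B.
Proof.
move=> NA NB; have sN := peripheral_star_algebra; apply/eqP; rewrite -subr_eq0.
apply/eqP/E_inj.
  apply: (star_algB sN); first by apply/dual_inv_in/(star_algM sN).
  by apply: (star_algM sN); exact: dual_inv_in.
rewrite linearB /= dual_invK; last exact: (star_algM sN).
by rewrite in_XT_mulE ?dual_invK ?subrr //; exact: dual_inv_in.
Qed.

Lemma dual_inv_adj A : in_XT E A -> dual_inv A^! = (dual_inv A)^!.
Proof.
move=> NA; have sN := peripheral_star_algebra; apply/eqP; rewrite -subr_eq0.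
apply/eqP/E_inj.
  by apply: (star_algB sN); [apply/dual_inv_in | apply: (star_alg_adj sN); apply/dual_inv_in];
    first exact: in_XT_starE.
rewrite linearB /= dual_invK; last exact: in_XT_starE.
by rewrite (dual_starE TE) dual_invK // subrr.
Qed.

Lemma dual_inv1 : dual_inv 1%:M = 1%:M.
Proof. by rewrite /dual_inv mul1mx Ts mulmxV // pd_unit. Qed.

End Faithful.

(** * Automorphisms of star-algebras *)

(* The columns of [U] are the normalised [g i i0 v], for [v] in the range of [g i0 i0]. *)
Lemma matrix_units_isometry (C : numClosedFieldType) m d (i0 : 'I_m)
    (g : 'I_m -> 'I_m -> 'M[C]_d) :
  (forall i j k l, g i j *m g k l = (j == k)%:R *: g i l) ->
  (forall i j, (g i j)^! = g j i) -> \sum_i g i i = 1%:M -> (0 < d)%N ->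
  exists U : 'M[C]_(d, m),
    U^! *m U = 1%:M /\ forall i j, g i j *m U = U *m delta_mx i j.
Proof.
move=> gM gA g1 d0.
(* Every [g i i] factors through [g i0 i0], and their sum is nonzero in positive dimension. *)
have g0 : g i0 i0 != 0.
  apply/eqP => g00; have : \sum_i g i i = 0.
    rewrite big1 // => i _; have := gM i i0 i0 i.
    rewrite eqxx scale1r => <-; have := gM i i0 i0 i0.
    by rewrite eqxx scale1r g00 mulmx0 => <-; rewrite mul0mx.
  by rewrite g1 => /matrixP/(_ (Ordinal d0) (Ordinal d0))/eqP; rewrite !mxE eqxx oner_eq0.
have [a va] : exists a, col a (g i0 i0) != 0.
  apply/existsP; apply: contraNT g0; rewrite negb_exists => /forallP h.
  apply/eqP/matrixP => i j; have := h j; rewrite negbK => /eqP/matrixP/(_ i 0).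
  by rewrite !mxE.
set v := col a _ in va.
have gv : g i0 i0 *m v = v by rewrite /v colE mulmxA gM eqxx scale1r.
pose c := \tr (v^! *m v).
have c0 : 0 < c.
  rewrite lt_def adjmul_tr_ge0 andbT; apply: contraNneq va => /adjmul_tr_eq0 ->.
  by [].
pose t := (sqrtC c)^-1.
have tt : t^* * t = c^-1.
  rewrite (CrealP _) ?rpredV ?ger0_real ?sqrtC_ge0 ?ltW //.
  by rewrite -invfM -expr2 sqrtCK.
pose U : 'M[C]_(d, m) := \matrix_(b, i) (t * (g i i0 *m v) b 0).
have colU i : col i U = t *: (g i i0 *m v).
  by apply/matrixP => b j; rewrite !mxE ord1.
exists U; split.
- apply/matrixP => i j; have -> : (U^! *m U) i j = ((col i U)^! *m col j U) 0 0.
    by rewrite !mxE; apply: eq_bigr => b _; rewrite !mxE.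
  rewrite !colU adjmxZ -scalemxAl -scalemxAr scalerA tt adjmxM gA mulmxA.
  rewrite -[_ *m g i0 i *m _]mulmxA gM -scalemxAr -scalemxAl -mulmxA gv.
  rewrite [RHS]mxE mxE [X in _ * X]mxE -trace_mx11 -/c.
  by rewrite mulrCA mulVf ?mulr1 // gt_eqF.
- move=> i j; apply/trmx_inj/row_matrixP => b; rewrite -!tr_col; congr _^T.
  rewrite [LHS]colE -mulmxA -colE colU.
  rewrite -scalemxAr mulmxA gM -scalemxAl colE -mulmxA -[j]/j.
  have -> : delta_mx i j *m delta_mx b 0 = (j == b)%:R *: delta_mx i 0 :> 'cV[C]_m.
    have [<-|jb] := eqVneq j b; first by rewrite mul_delta_mx scale1r.
    by rewrite mul_delta_mx_0 // scale0r.
  by rewrite -scalemxAr -colE colU !scalerA mulrC.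
Qed.

(** Comparing entries in column [o] of the commutation with [delta_mx i o] determines column [i] of
    [M]. *)
Lemma central_scalar (R : nzRingType) d (M : 'M[R]_d) (o : 'I_d) :
  (forall i j, M *m delta_mx i j = delta_mx i j *m M) -> M = (M o o)%:M.
Proof.
move=> Mc; apply/matrixP => a i; have := Mc i o => /matrixP/(_ a o).
rewrite !mxE (bigD1 i) //= big1 => [|b bi]; last by rewrite mxE (negPf bi) mulr0.
rewrite [X in _ = X](bigD1 o) //= big1 => [|b bi].
  rewrite !mxE !eqxx andbT mulr1 !addr0 => ->.
  by case: eqP; rewrite ?mul1r ?mul0r ?mulr1n.
by rewrite mxE (negPf bi) andbF mul0r.
Qed.

Section Automorphism.
Variables (C : numClosedFieldType) (n K : nat) (d1 d2 : 'I_K -> nat).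
Variable B : forall k, 'I_(d1 k) -> 'M[C]_(d2 k, n).
Arguments B : clear implicits.
Hypotheses (d1_gt0 : forall k, (0 < d1 k)%N) (d2_gt0 : forall k, (0 < d2 k)%N).
Hypothesis oB : ortho_blocks B.
Variable N : 'M[C]_n -> Prop.
Hypothesis sN : star_algebra N.
Hypothesis NB : forall k i j, N ((B k i)^! *m B k j).
Hypothesis NE : forall A, N A -> exists x, A = blkmx B (fun=> 1%:M) x.
Hypothesis B1 : blkmx B (fun=> 1%:M) (fun=> 1%:M) = 1%:M.

Let iota := blkmx B (fun=> 1%:M).
Definition blkunit k i j := (B k i)^! *m B k j.
Arguments blkunit : clear implicits.

Lemma blkunitMs k i j a b :
  blkunit k i j *m blkunit k a b = (j == a)%:R *: blkunit k i b.
Proof.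
case: oB => oBk _; rewrite /blkunit mulmxA -[_ *m _ *m (B k a)^!]mulmxA.
by rewrite oBk mul_mx_scalar -scalemxAl.
Qed.

Lemma blkunitMd k i j l a b : k != l -> blkunit k i j *m blkunit l a b = 0.
Proof.
move=> kl; case: oB => _ oBkl.
by rewrite /blkunit mulmxA -[_ *m _ *m (B l a)^!]mulmxA oBkl // mulmx0 mul0mx.
Qed.

Lemma blkmx_unitE x : iota x = \sum_k \sum_i \sum_j x k i j *: blkunit k i j.
Proof. by do 3!apply: eq_bigr => ? _; rewrite mulmx1. Qed.

(** Normalised partial trace over the second tensor factor: a left inverse of [iota], defined and
    linear on all matrices. *)
Definition blkcoord l (A : 'M[C]_n) : 'M[C]_(d1 l) :=
  \matrix_(i, j) (\tr (B l i *m A *m (B l j)^!) / (d2 l)%:R).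

Lemma blkcoord_blkmx l x : blkcoord l (iota x) = x l.
Proof.
apply/matrixP => i j; rewrite mxE blkmx_coord // mxtraceZ mxtrace1 mulfK //.
by rewrite pnatr_eq0 -lt0n.
Qed.

Lemma blkcoord_linear l : linear (blkcoord l).
Proof.
move=> a X Y; apply/matrixP => i j; rewrite !mxE mulmxDr mulmxDl -scalemxAr -scalemxAl.
by rewrite linearP /= mulrDl mulrA.
Qed.

HB.instance Definition _ l :=
  GRing.isLinear.Build C 'M[C]_n 'M[C]_(d1 l) _ (blkcoord l) (@blkcoord_linear l).

Lemma blkcoordK A : N A -> iota (fun l => blkcoord l A) = A.
Proof.
by move=> /NE [x ->]; apply: eq_blkmx => l; rewrite blkcoord_blkmx.
Qed.

Lemma blkmx1M x y : iota x *m iota y = iota (fun k => x k *m y k).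
Proof.
rewrite /iota blkmxM //.
by apply: eq_bigr => k _; apply: eq_bigr => i _; apply: eq_bigr => j _; rewrite mulmx1.
Qed.

Lemma blkcoordM l A A' : N A -> N A' ->
  blkcoord l (A *m A') = blkcoord l A *m blkcoord l A'.
Proof.
by move=> /NE [x ->] /NE [y ->]; rewrite blkmx1M !blkcoord_blkmx.
Qed.

Lemma blkcoord_adj l A : N A -> blkcoord l A^! = (blkcoord l A)^!.
Proof.
move=> /NE [x ->]; rewrite blkmx_adj; last by move=> k; exact: adjmx1.
by rewrite !blkcoord_blkmx.
Qed.

Lemma blkcoord1 l : blkcoord l 1%:M = 1%:M.
Proof. by rewrite -B1 blkcoord_blkmx. Qed.

Lemma blkcoord_unit l i j : blkcoord l (blkunit l i j) = delta_mx i j.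
Proof.
case: oB => oBk _; apply/matrixP => a b.
rewrite !mxE /blkunit !mulmxA oBk -mulmxA oBk -scalar_mxM mxtrace_scalar.
rewrite -[_ *+ d2 l]mulr_natr mulfK; last by rewrite pnatr_eq0 -lt0n.
by rewrite -natrM mulnb [j == b]eq_sym.
Qed.

Variable Psi : {linear 'M[C]_n -> 'M[C]_n}.
Hypothesis PsiN : forall A, N A -> N (Psi A).
Hypothesis PsiM : forall A A', N A -> N A' -> Psi (A *m A') = Psi A *m Psi A'.
Hypothesis PsiA : forall A, N A -> Psi A^! = (Psi A)^!.
Hypothesis Psi1 : Psi 1%:M = 1%:M.
Hypothesis Psi_inj : forall A, N A -> Psi A = 0 -> A = 0.
Hypothesis Psi_surj : forall A, N A -> exists2 A', N A' & Psi A' = A.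

Let h l A := blkcoord l (Psi A).

Let hM l A A' : N A -> N A' -> h l (A *m A') = h l A *m h l A'.
Proof. by move=> NA NA'; rewrite /h PsiM // blkcoordM //; exact: PsiN. Qed.

Let h_inj A : N A -> (forall l, h l A = 0) -> A = 0.
Proof.
move=> NA hA; apply: Psi_inj => //; rewrite -(blkcoordK (PsiN NA)).
rewrite blkmx_unitE big1 // => k _; rewrite big1 // => i _; rewrite big1 // => j _.
by move: (hA k); rewrite /h => ->; rewrite mxE scale0r.
Qed.

(** The minimal central projections of the algebra. *)
Definition blkcenter k := \sum_i blkunit k i i.

Let Nz k : N (blkcenter k).
Proof. by apply: star_alg_sum => // i _; exact: NB. Qed.

Lemma blkcenter_unit k i j : blkcenter k *m blkunit k i j = blkunit k i j.
Proof.
rewrite mulmx_suml (bigD1 i) //= big1 ?addr0 => [|a ai]; rewrite blkunitMs.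
  by rewrite eqxx scale1r.
by rewrite (negPf ai) scale0r.
Qed.

Lemma unit_blkcenter k i j : blkunit k i j *m blkcenter k = blkunit k i j.
Proof.
rewrite mulmx_sumr (bigD1 j) //= big1 ?addr0 => [|a ai]; rewrite blkunitMs.
  by rewrite eqxx scale1r.
by rewrite eq_sym (negPf ai) scale0r.
Qed.

Lemma blkcenter_unit0 k l i j : k != l -> blkcenter k *m blkunit l i j = 0.
Proof. by move=> kl; rewrite mulmx_suml big1 // => a _; rewrite blkunitMd. Qed.

Lemma unit_blkcenter0 k l i j : l != k -> blkunit l i j *m blkcenter k = 0.
Proof. by move=> kl; rewrite mulmx_sumr big1 // => a _; rewrite blkunitMd. Qed.

Lemma blkcenter_mul k l : blkcenter k *m blkcenter l = (k == l)%:R *: blkcenter k.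
Proof.
rewrite {2}/blkcenter mulmx_sumr; case: eqP => [<-|/eqP kl].
  by rewrite scale1r; apply: eq_bigr => i _; rewrite blkcenter_unit.
by rewrite scale0r big1 // => i _; rewrite blkcenter_unit0.
Qed.

Lemma blkcenter_comm k A : N A -> blkcenter k *m A = A *m blkcenter k.
Proof.
move=> /NE [x ->]; rewrite -/(iota x) blkmx_unitE [LHS]mulmx_sumr [RHS]mulmx_suml.
apply: eq_bigr => l _; rewrite [LHS]mulmx_sumr [RHS]mulmx_suml.
apply: eq_bigr => i _; rewrite [LHS]mulmx_sumr [RHS]mulmx_suml.
apply: eq_bigr => j _; rewrite -[LHS]scalemxAr -[RHS]scalemxAl; congr (_ *: _).
have [->|kl] := eqVneq k l; first by rewrite blkcenter_unit unit_blkcenter.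
by rewrite blkcenter_unit0 // unit_blkcenter0 // eq_sym.
Qed.

Lemma sum_blkcenter : \sum_k blkcenter k = 1%:M.
Proof.
rewrite -B1 -/(iota _) blkmx_unitE; apply: eq_bigr => k _; apply: eq_bigr => i _.
rewrite (bigD1 i) //= big1 ?addr0 => [|j ji]; first by rewrite mxE eqxx scale1r.
by rewrite mxE eq_sym (negPf ji) scale0r.
Qed.

(** Since [h l] maps onto the full matrix algebra, the image of a central projection is a scalar
    idempotent. *)
Let h_center l k : h l (blkcenter k) = 0 \/ h l (blkcenter k) = 1%:M.
Proof.
set M := h l _; pose o := Ordinal (d1_gt0 l).
have Mc i j : M *m delta_mx i j = delta_mx i j *m M.
  have [A NA PA] := Psi_surj (NB i j).
  have -> : delta_mx i j = h l A by rewrite /h PA blkcoord_unit.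
  by rewrite -!hM // blkcenter_comm.
have := central_scalar o Mc; move: (M o o) => c ME.
have : M *m M = M by rewrite -hM // blkcenter_mul eqxx scale1r.
rewrite ME -scalar_mxM => /matrixP/(_ o o); rewrite !mxE eqxx !mulr1n => /eqP.
rewrite -subr_eq0 -{3}[c]mulr1 -mulrBr mulf_eq0 subr_eq0 => /orP [] /eqP ->.
  by left; rewrite raddf0.
by right.
Qed.

Let one_neq0 l : (1%:M : 'M[C]_(d1 l)) <> 0.
Proof.
move=> /matrixP/(_ (Ordinal (d1_gt0 l)) (Ordinal (d1_gt0 l)))/eqP.
by rewrite !mxE eqxx oner_eq0.
Qed.

(** The images of the central projections sum to the identity, so block [l] sees one of them, unique
    by orthogonality. Injectivity of [Psi] means that each is seen somewhere, and a surjection of a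
    finite set is a permutation. *)
Let center_perm : exists pi : {perm 'I_K}, forall l, h l (blkcenter (pi l)) = 1%:M.
Proof.
have ex l : exists k, h l (blkcenter k) = 1%:M.
  apply: NNPP => none; apply: (@one_neq0 l).
  rewrite -(blkcoord1 l) -Psi1 -sum_blkcenter !linear_sum big1 //= => k _.
  by have [//|h1] := h_center l k; case: none; exists k.
have [f fP] := fin_all_exists ex.
have surj k : exists l, f l = k.
  apply: NNPP => none.
  have zk : blkcenter k = 0.
    apply: h_inj => // l; have [//|h1] := h_center l k; case: none; exists l.
    apply/eqP/negPn/negP => fk; apply: (@one_neq0 l).
    rewrite -[LHS]mulmx1 -{1}(fP l) -h1 -hM // blkcenter_mul (negPf fk) scale0r.
    by rewrite /h !linear0.
  have := blkcenter_unit (Ordinal (d1_gt0 k)) (Ordinal (d1_gt0 k)).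
  rewrite zk mul0mx => /esym/(congr1 (blkcoord k)); rewrite blkcoord_unit linear0.
  move=> /matrixP/(_ (Ordinal (d1_gt0 k)) (Ordinal (d1_gt0 k)))/eqP.
  by rewrite !mxE !eqxx oner_eq0.
have [g gP] := fin_all_exists surj.
have g_inj : injective g by move=> k k' /(congr1 f); rewrite !gP.
exists (perm g_inj)^-1%g => l.
have -> : (perm g_inj)^-1%g l = f l.
  by rewrite -[X in f X](permKV (perm g_inj)) permE gP.
exact: fP.
Qed.

(** Block [l] contains the image of the matrix units of block [pi l], which [matrix_units_isometry]
    intertwines with the standard ones. [U k] is typed as rectangular since the two sizes agree only
    propositionally. *)
Theorem blkmx_automorphism : exists pi : {perm 'I_K},
  (forall k, d1 (pi k) = d1 k) /\
  exists U : forall k, 'M[C]_(d1 k, d1 (pi k)),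
    (forall k, U k *m (U k)^! = 1%:M /\ (U k)^! *m U k = 1%:M) /\
    forall x, N (iota x) -> Psi (iota x) = iota (fun k => U k *m x (pi k) *m (U k)^!).
Proof.
have [pi hpi] := center_perm; exists pi.
have hU l : exists U : 'M[C]_(d1 l, d1 (pi l)), U^! *m U = 1%:M /\
    forall i j, h l (blkunit (pi l) i j) *m U = U *m delta_mx i j.
  apply: (matrix_units_isometry (Ordinal (d1_gt0 (pi l)))
     (g := fun i j => h l (blkunit (pi l) i j))) => //.
  - by move=> i j a b; rewrite -hM ?blkunitMs /h ?linearZ //; exact: NB.
  - move=> i j; rewrite /h -blkcoord_adj; last exact/PsiN/NB.
    rewrite -PsiA; last exact: NB.
    by rewrite /blkunit adjmxM adjmxK.
  - by rewrite -(hpi l) /h /blkcenter !linear_sum.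
have [U UP] := fin_all_exists hU.
have le_d l : (d1 (pi l) <= d1 l)%N.
  have [UU _] := UP l; rewrite -(mxrank1 C (d1 (pi l))) -UU.
  by apply: leq_trans (mxrankM_maxr _ _) (rank_leq_row _).
(* The isometries give inequalities whose two sides have equal sums over a permutation. *)
have eq_d l : d1 (pi l) = d1 l.
  have [_] := leqif_sum (fun i (_ : predT i) =>
    conj (le_d i) (erefl (d1 (pi i) == d1 i))).
  rewrite -(reindex_inj (@perm_inj _ pi) (P := predT) (F := d1)) eqxx.
  by move=> /esym/forallP/(_ l)/eqP.
have UUr l : U l *m (U l)^! = 1%:M.
  have uU : (U l)^! \is unitarymx.
    by apply/unitarymx_adjP; rewrite adjmxK; case: (UP l).
  have := mulmxKtV 1%:M uU (eq_d l); rewrite mul1mx.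
  by move=> <-; congr (_ *m _); rewrite -/(adjmx _) adjmxK.
split=> //; exists U; split=> [l|x Nx]; first by case: (UP l).
rewrite -(blkcoordK (PsiN Nx)); apply: eq_blkmx => l; rewrite -/(h l _).
have [UU gU] := UP l.
have -> : h l (iota x) = \sum_i \sum_j x (pi l) i j *: h l (blkunit (pi l) i j).
  rewrite /h blkmx_unitE !linear_sum (bigD1 (pi l)) //= [X in _ + X]big1 ?addr0.
    rewrite !linear_sum; apply: eq_bigr => i _; rewrite !linear_sum.
    by apply: eq_bigr => j _; rewrite !linearZ.
  (* The other blocks contribute nothing: their central projections are orthogonal to that of
     [pi l], which [h l] sends to the identity. *)
  move=> k kl; rewrite !linear_sum big1 //= => i _; rewrite !linear_sum big1 //= => j _.
  rewrite !linearZ /= -/(h l _) -(blkcenter_unit i j) hM //; last exact: NB.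
  suff -> : h l (blkcenter k) = 0 by rewrite mul0mx scaler0.
  rewrite -[LHS]mulmx1 -(hpi l) -hM // blkcenter_mul (negPf kl) scale0r.
  by rewrite /h !linear0.
rewrite [x (pi l) in RHS]matrix_sum_delta mulmx_sumr mulmx_suml.
apply: eq_bigr => i _; rewrite mulmx_sumr mulmx_suml; apply: eq_bigr => j _.
by rewrite -scalemxAr -scalemxAl -gU -mulmxA (UUr l) mulmx1.
Qed.

End Automorphism.

Lemma pd_congr_isometry (C : numClosedFieldType) m n (B : 'M[C]_(m, n)) (A : 'M_n) :
  pdmx A -> B *m B^! = 1%:M -> pdmx (B *m A *m B^!).
Proof.
move=> pA BB; split; first by case: (psd_congr B (pd_psd pA)).
move=> v v0; have := proj2 pA (v *m B); rewrite adjmxM !mulmxA; apply.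
by apply: contraNneq v0 => vB; rewrite -[v]mulmx1 -BB mulmxA vB mul0mx.
Qed.

Lemma pd_tr_gt0 (C : numClosedFieldType) n (A : 'M[C]_n) :
  (0 < n)%N -> pdmx A -> 0 < \tr A.
Proof.
move=> n0 pA; rewrite lt_def (psd_tr_ge0 (pd_psd pA)) andbT.
apply/eqP => /(psd_tr_eq0 (pd_psd pA)) A0.
have : (delta_mx 0 (Ordinal n0) : 'rV[C]_n) != 0.
  apply/eqP => /matrixP/(_ 0 (Ordinal n0))/eqP; rewrite !mxE !eqxx.
  by rewrite oner_eq0.
by move/(proj2 pA); rewrite A0 mulmx0 mul0mx mxE ltxx.
Qed.

Lemma pdZ (C : numClosedFieldType) n a (A : 'M[C]_n) : 0 < a -> pdmx A -> pdmx (a *: A).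
Proof.
move=> a0 pA; split; first by case: (psdZ (ltW a0) (pd_psd pA)).
by move=> v v0; rewrite -scalemxAr -scalemxAl mxE mulr_gt0 //; case: pA => _; apply.
Qed.

(** * Both assertions for a map with a faithful fixed point *)

Section FaithfulStructure.
Variables (C : numClosedFieldType) (n : nat) (T E : {linear 'M[C]_n -> 'M[C]_n}).
Variable s : 'M[C]_n.
Hypotheses (TE : schwarz_dual T E) (pds : pdmx s) (Ts : T s = s).

Theorem faithful_structure :
  exists (K : nat) (d1 d2 : 'I_K -> nat)
         (B : forall k, 'I_(d1 k) -> 'M[C]_(d2 k, n)) (rho : forall k, 'M[C]_(d2 k)),
  [/\ (forall k, 0 < d1 k)%N /\ (forall k, 0 < d2 k)%N, ortho_blocks B,
      blkmx B (fun=> 1%:M) (fun=> 1%:M) = 1%:M, forall k, pd_density (rho k) &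
      forall X, in_XT T X <-> exists x, X = blkmx B rho x] /\
  exists pi : {perm 'I_K},
    (forall k, d1 (pi k) = d1 k) /\
    exists U : forall k, 'M[C]_(d1 k, d1 (pi k)),
      (forall k, U k *m (U k)^! = 1%:M) /\
      forall x, T (blkmx B rho x) = blkmx B rho (fun k => U k *m x (pi k) *m (U k)^!).
Proof.
have sN := peripheral_star_algebra TE pds Ts.
have [K [d1 [d2 [B [[d1_gt0 d2_gt0] oB NB NE B1]]]]] :=
  star_algebra_blocks sN (in_XT_E1 TE).
have [oBk oBkl] := oB.
pose o k := Ordinal (d1_gt0 k); pose R k := B k (o k) *m s *m (B k (o k))^!.
have pR k : pdmx (R k) by apply: pd_congr_isometry => //; rewrite oBk eqxx.
have tR k : 0 < \tr (R k) by apply: pd_tr_gt0.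
pose rho k := (\tr (R k))^-1 *: R k.
have rho1 k : \tr (rho k) = 1 by rewrite mxtraceZ mulVf // gt_eqF.
(* The bimodule structure moves the corner of [s] at the minimal projection [o k] to any position
   [i], [j]. *)
have NXrho x : in_XT T (blkmx B rho x).
  apply: in_XT_sum => k _; apply: in_XT_sum => i _; apply: in_XT_sum => j _.
  have -> : (B k i)^! *m rho k *m B k j = (\tr (R k))^-1 *:
      ((B k i)^! *m B k (o k) *m s *m ((B k (o k))^! *m B k j)).
    by rewrite -scalemxAr -scalemxAl /R !mulmxA.
  rewrite scalerA -[_ *: _]addr0; apply: in_XT_lin; last exact: in_XT0.
  apply: (in_XT_mulr TE pds Ts) => //; apply: (in_XT_mull TE pds Ts) => //.
  exact: in_XT_fixed.
have tr_rho x y : \tr (blkmx B rho x *m blkmx B (fun=> 1%:M) y) =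
    \sum_k \tr (x k *m y k).
  by rewrite blkmxM // mxtrace_blkmx // => k; rewrite mulmx1.
have XTE X : in_XT T X <-> exists x, X = blkmx B rho x.
  split=> [XX|[x ->] //].
  (* Coordinates against the matrix units; [i] and [j] are swapped because the trace pairs entry
     [(i, j)] with entry [(j, i)]. *)
  exists (fun k => \matrix_(i, j) \tr (X *m ((B k j)^! *m B k i))).
  apply/eqP; rewrite -subr_eq0; apply/eqP/(in_XT_pairing TE pds Ts).
    by rewrite addrC -scaleN1r; apply: in_XT_lin.
  move=> A /NE [y ->]; rewrite mulmxBl linearB /= tr_rho; apply/eqP.
  rewrite subr_eq0; apply/eqP; rewrite mulmx_sumr linear_sum; apply: eq_bigr => k _.
  rewrite [RHS]/mxtrace; under [RHS]eq_bigr do rewrite mxE.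
  rewrite [RHS]exchange_big mulmx_sumr linear_sum; apply: eq_bigr => i _.
  rewrite mulmx_sumr linear_sum; apply: eq_bigr => j _ /=.
  by rewrite mxE mulmx1 -scalemxAr mxtraceZ mulrC.
exists K, d1, d2, B, rho; split.
  split=> // k; split=> //; apply: pdZ; rewrite // invr_gt0 //.
pose Psi : {linear 'M[C]_n -> 'M[C]_n} := dual_inv T s.
have PsiK A : in_XT E A -> E (Psi A) = A by exact: dual_invK.
have Psi_inj A : in_XT E A -> Psi A = 0 -> A = 0.
  by move=> NA PA; rewrite -(PsiK A NA) PA linear0.
have [pi [dpi [U [UU PsiU]]]] := blkmx_automorphism d1_gt0 d2_gt0 oB sN NB NE B1
  (dual_inv_in TE pds Ts) (dual_inv_mul TE pds Ts) (dual_inv_adj TE pds Ts) (dual_inv1 pds Ts)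
  Psi_inj (dual_inv_surj TE pds Ts).
exists pi; split=> //; exists U; split=> [k|x]; first by case: (UU k).
apply/eqP; rewrite -subr_eq0; apply/eqP/(in_XT_pairing TE pds Ts).
  by rewrite addrC -scaleN1r; apply: in_XT_lin => //; exact: in_XT_T.
(* Testing against [Psi A] suffices: [\tr (T X *m Psi A) = \tr (X *m A)] because [E] undoes [Psi].
   The claimed formula gives the same value after reindexing by [pi]. *)
move=> _ /(dual_inv_surj TE pds Ts) [A NA <-]; have [y AE] := NE A NA.
rewrite mulmxBl linearB /= -(dual_adj TE) PsiK // {1}AE tr_rho AE PsiU -?AE //.
rewrite tr_rho (reindex_inj (@perm_inj _ pi)) /=; apply/eqP; rewrite subr_eq0.
apply/eqP/eq_bigr => k _; have [_ UkU] := UU k.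
have -> : U k *m x (pi k) *m (U k)^! *m (U k *m y (pi k) *m (U k)^!) =
    U k *m x (pi k) *m ((U k)^! *m U k) *m y (pi k) *m (U k)^! by rewrite !mulmxA.
by rewrite UkU mulmx1 [RHS]mxtrace_mulC !mulmxA UkU mul1mx.
Qed.

End FaithfulStructure.

(** * The adapted orthonormal basis *)

Section Stacking.
Variables (C : numClosedFieldType) (m p n : nat).
Implicit Types F G : 'I_m -> 'M[C]_(p, n).

Lemma pair_of_mxvec_indexK (i : 'I_m) (j : 'I_p) :
  pair_of_mxvec_index (mxvec_indexP (mxvec_index i j)) = (i, j).
Proof.
have inj : injective (fun ij : 'I_m * 'I_p => mxvec_index ij.1 ij.2).
  by move=> [a b] [a' b'] /cast_ord_inj/enum_rank_inj.
by apply: inj; case: (mxvec_indexP _).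
Qed.

Lemma mxvec_index_eq (i i' : 'I_m) (j j' : 'I_p) :
  (mxvec_index i j == mxvec_index i' j') = (i == i') && (j == j').
Proof.
rewrite -xpair_eqE; apply/eqP/eqP => [|[-> ->] //] e.
by rewrite -[LHS]pair_of_mxvec_indexK e pair_of_mxvec_indexK.
Qed.

Lemma kronmxE (x : 'M[C]_m) (rho : 'M[C]_p) i j a b :
  kronmx x rho (mxvec_index i a) (mxvec_index j b) = x i j * rho a b.
Proof. by rewrite mxE !pair_of_mxvec_indexK. Qed.

(** The isometry [e_i (x) 1], in the index ordering of [kronmx]. *)
Definition slot (i : 'I_m) : 'M[C]_(m * p, p) :=
  \matrix_(k, a) (k == mxvec_index i a)%:R.

Lemma slot_adj_mul (A : 'M[C]_(m * p)) i j :
  (slot i)^! *m A *m slot j = \matrix_(a, b) A (mxvec_index i a) (mxvec_index j b).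
Proof.
apply/matrixP => a b; rewrite !mxE (bigD1 (mxvec_index j b)) //= big1 => [|k kj].
  rewrite !mxE eqxx mulr1 addr0 (bigD1 (mxvec_index i a)) //= big1 => [|k ki].
    by rewrite !mxE eqxx conjC1 mul1r addr0.
  by rewrite !mxE (negPf ki) conjC0 mul0r.
by rewrite [X in _ * X]mxE (negPf kj) mulr0.
Qed.

Lemma sum_slot : \sum_i slot i *m (slot i)^! = 1%:M.
Proof.
apply/matrixP => k l; rewrite summxE; case/mxvec_indexP: k => i a.
rewrite (bigD1 i) //= big1 => [|j ji].
  rewrite mxE (bigD1 a) //= big1 => [|b ba].
    by rewrite !mxE eqxx mul1r !addr0 eq_sym conjC_nat.
  by rewrite !mxE mxvec_index_eq [a == b]eq_sym (negPf ba) andbF mul0r.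
rewrite mxE big1 // => b _.
by rewrite !mxE mxvec_index_eq [i == j]eq_sym (negPf ji) mul0r.
Qed.

Definition stackmx F : 'M[C]_(m * p, n) := \sum_i slot i *m F i.

Lemma stackmx_kron F x rho :
  (stackmx F)^! *m kronmx x rho *m stackmx F =
  \sum_i \sum_j x i j *: ((F i)^! *m rho *m F j).
Proof.
rewrite adjmx_sum !mulmx_suml; apply: eq_bigr => i _.
rewrite mulmx_sumr; apply: eq_bigr => j _.
have -> : (slot i *m F i)^! *m kronmx x rho *m (slot j *m F j) =
    (F i)^! *m ((slot i)^! *m kronmx x rho *m slot j) *m F j.
  by rewrite adjmxM !mulmxA.
have -> : (slot i)^! *m kronmx x rho *m slot j = x i j *: rho.
  by rewrite slot_adj_mul; apply/matrixP => a b; rewrite mxE kronmxE mxE.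
by rewrite -scalemxAr -scalemxAl.
Qed.

Lemma stackmx_orthonormal F :
  (forall i j, F i *m (F j)^! = ((i == j)%:R)%:M) ->
  stackmx F *m (stackmx F)^! = 1%:M.
Proof.
move=> FF; rewrite -sum_slot mulmx_suml; apply: eq_bigr => i _.
rewrite adjmx_sum mulmx_sumr (bigD1 i) //= big1 => [|j ji].
  by rewrite addr0 adjmxM mulmxA -[_ *m F i *m _]mulmxA FF eqxx mulmx1.
rewrite adjmxM mulmxA -[_ *m F i *m _]mulmxA FF eq_sym (negPf ji).
by rewrite raddf0 mulmx0 mul0mx.
Qed.

End Stacking.

Lemma kronmx1 (C : numClosedFieldType) m p :
  kronmx (1%:M : 'M[C]_m) (1%:M : 'M[C]_p) = 1%:M.
Proof.
apply/matrixP => k l; case/mxvec_indexP: k => i a; case/mxvec_indexP: l => j b.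
by rewrite kronmxE !mxE mxvec_index_eq -natrM mulnb.
Qed.

Lemma stackmx_ortho0 (C : numClosedFieldType) m p m' p' n
    (F : 'I_m -> 'M[C]_(p, n)) (G : 'I_m' -> 'M[C]_(p', n)) :
  (forall i j, F i *m (G j)^! = 0) -> stackmx F *m (stackmx G)^! = 0.
Proof.
move=> FG; rewrite mulmx_suml big1 // => i _; rewrite adjmx_sum mulmx_sumr big1 // => j _.
by rewrite adjmxM mulmxA -[_ *m F i *m _]mulmxA FG mulmx0 mul0mx.
Qed.

Section Assembly.
Variables (C : numClosedFieldType) (n d0 K : nat) (d1 d2 : 'I_K -> nat).
Variables (W0 : 'M[C]_(d0, n)) (B : forall k, 'I_(d1 k) -> 'M[C]_(d2 k, n)).
Arguments B : clear implicits.

Definition adapted_basis : 'M[C]_(d0 + \sum_(k < K) (d1 k * d2 k), n) :=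
  col_mx W0 (\mxcol_k stackmx (B k)).

Lemma adjmx_adapted_basis : adjmx adapted_basis =
  row_mx W0^! (\mxrow_k (stackmx (B k))^!).
Proof.
rewrite /adjmx tr_col_mx map_row_mx; congr row_mx.
by apply/matrixP => i j; rewrite !mxE.
Qed.

(** The zero corner removes [W0], and each diagonal block expands by [stackmx_kron]. *)
Lemma embed_adapted_basis rho x : embed adapted_basis rho x = blkmx B rho x.
Proof.
rewrite /embed adjmx_adapted_basis /adapted_basis mul_row_block !mulmx0 !add0r.
rewrite mul_row_col mul0mx add0r mul_mxrow_mxdiag mul_mxrow_mxcol.
by apply: eq_bigr => k _; exact: stackmx_kron.
Qed.

Hypothesis oB : ortho_blocks B.
Hypothesis W01 : W0 *m W0^! = 1%:M.
Hypothesis W0B : forall k i, B k i *m W0^! = 0.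
Hypothesis WB1 : W0^! *m W0 + blkmx B (fun=> 1%:M) (fun=> 1%:M) = 1%:M.

Lemma adapted_basis_unitary : adapted_basis *m (adapted_basis)^! = 1%:M.
Proof.
have [oBk oBkl] := oB.
have sW0 k : stackmx (B k) *m W0^! = 0.
  by rewrite mulmx_suml big1 // => i _; rewrite -mulmxA W0B mulmx0.
rewrite adjmx_adapted_basis mul_col_row W01 scalar_mx_block; congr block_mx.
- rewrite mul_mxrow; apply/matrixP => i j; rewrite mxE -[X in X *m _]adjmxK.
  by rewrite -adjmxM sW0 adjmx0 !mxE.
- by rewrite mxcol_mul; apply/matrixP => i j; rewrite mxE sW0 !mxE.
- rewrite mul_mxcol_mxrow -mxdiagZ; apply: eq_mxblock => k l.
  have [<-|kl] := eqVneq k l.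
    by rewrite conform_mx_id stackmx_orthonormal.
  by apply: stackmx_ortho0 => i j; exact: oBkl.
Qed.

Lemma adapted_basis_adj_unitary : (adapted_basis)^! *m adapted_basis = 1%:M.
Proof.
rewrite -WB1 -embed_adapted_basis /embed adjmx_adapted_basis /adapted_basis.
rewrite mul_row_block !mulmx0 !add0r !mul_row_col mul0mx add0r; congr (_ + _).
congr (_ *m _); rewrite mul_mxrow_mxdiag; apply: eq_mxrow => k.
by rewrite kronmx1 mulmx1.
Qed.

End Assembly.

(** * Combination of the support reduction with the faithful case *)

Unset Implicit Arguments.
Set Strict Implicit.
Set Printing Implicit Defensive.

Theorem theorem8 (C : numClosedFieldType) (d : nat) (T : 'M[C]_d -> 'M[C]_d) :
  tp_schwarz_map T ->
  exists (d0 K : nat) (d1 d2 : 'I_K -> nat)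
         (W : 'M[C]_(d0 + \sum_(k < K) (d1 k * d2 k), d))
         (rho : forall k, 'M[C]_(d2 k)),
    W \is unitarymx /\ adjmx W \is unitarymx /\
    (forall k, 0 < d1 k)%N /\ (forall k, 0 < d2 k)%N /\
    (forall k, pd_density (rho k)) /\
    (forall X, in_XT T X <-> exists x : forall k, 'M[C]_(d1 k),
                               X = embed W rho x) /\
        exists pi : {perm 'I_K},
          (forall k, d1 (pi k) = d1 k) /\
          exists U : forall k, 'M[C]_(d1 k, d1 (pi k)),
            (forall k, U k \is unitarymx) /\
            forall x : forall k, 'M[C]_(d1 k),
              T (embed W rho x) =
              embed W rho (fun k => U k *m x (pi k) *m adjmx (U k)).
Proof.
move=> hT; have [T' TT'] : exists T' : {linear 'M[C]_d -> 'M[C]_d}, T = T'.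
  pose T' : {linear 'M[C]_d -> 'M[C]_d} :=
    HB.pack T (GRing.isLinear.Build C _ _ _ T (proj1 hT)).
  by exists T'.
move: hT; rewrite {}TT' {T}; move: T' => T [_ [posT [trT [E [adjE schE]]]]].
(* The adjoint is given as a bare function; its linearity comes from the trace pairing. *)
have E_linear : linear E.
  move=> a A A'; apply: mxtrace_pairing_inj => X.
  by rewrite mulmxDr -scalemxAr !linearD !linearZ /= !adjE mulmxDr -scalemxAr linearD
    linearZ.
pose E' : {linear 'M[C]_d -> 'M[C]_d} :=
  HB.pack E (GRing.isLinear.Build C _ _ _ E E_linear).
have starT A : T A^! = (T A)^!.
  elim/psd_span_ind: A => [a A A' IA IA'|A pA].
    by rewrite adjmxD adjmxZ !(linearP T) /= IA IA' adjmxD adjmxZ.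
  by rewrite !psd_adj //; exact: posT.
have starE A : E A^! = (E A)^!.
  apply: mxtrace_pairing_inj => X; rewrite adjE.
  rewrite -[X in \tr X]adjmxK mxtrace_adj adjmxM adjmxK -starT mxtrace_mulC -adjE.
  by rewrite -mxtrace_adj adjmxM adjmxK mxtrace_mulC.
have TE : schwarz_dual T E'.
  split=> //=.
    by apply: mxtrace_pairing_inj => X; rewrite adjE !mulmx1 trT.
  by move=> A; rewrite -starE; exact: schE.
have [r [V [s [VV TE' [pds Ts] TVV XTV]]]] := support_reduction TE.
have [K [d1 [d2 [B [rho [[[d1_gt0 d2_gt0] oB B1 prho XTE] [pi [dpi [U [UU TU]]]]]]]]]] :=
  faithful_structure TE' pds Ts.
have oQ : orthoproj (1%:M - V^! *m V).
  apply: proj1B; split; first by rewrite adjmxM adjmxK.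
  by rewrite mulmxA -[_ *m V *m _]mulmxA VV mulmx1.
(* The rows of [W0] are an orthonormal basis of [H_0], the complement of the support of the maximal
   fixed point. *)
have [W0 [W01 W0Q]] := proj_isometry oQ.
pose BV k i := B k i *m V.
have BVE rho' x : blkmx BV rho' x = V^! *m blkmx B rho' x *m V.
  rewrite mulmx_sumr mulmx_suml; apply: eq_bigr => k _.
  rewrite mulmx_sumr mulmx_suml; apply: eq_bigr => i _.
  rewrite mulmx_sumr mulmx_suml; apply: eq_bigr => j _.
  by rewrite -scalemxAr -scalemxAl adjmxM !mulmxA.
have oBV : ortho_blocks BV.
  have VM k l i j : BV k i *m (BV l j)^! = B k i *m (B l j)^!.
    by rewrite adjmxM mulmxA -[_ *m V *m _]mulmxA VV mulmx1.
  by case: oB => oBk oBkl; split=> *; rewrite VM; [exact: oBk | exact: oBkl].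
have W0BV k i : BV k i *m W0^! = 0.
  have VW0 : V *m W0^! = 0.
    rewrite -[LHS]mulmx1 -W01 !mulmxA -[_ *m W0^! *m W0]mulmxA W0Q.
    by rewrite mulmxBr mulmx1 mulmxA VV mul1mx subrr mul0mx.
  by rewrite -mulmxA VW0 mulmx0.
have WB1 : W0^! *m W0 + blkmx BV (fun=> 1%:M) (fun=> 1%:M) = 1%:M.
  by rewrite BVE B1 mulmx1 W0Q subrK.
exists _, K, d1, d2, (adapted_basis W0 BV), rho.
split; first by apply/unitarymx_adjP/adapted_basis_unitary.
split; first by apply/unitarymx_adjP; rewrite adjmxK; exact: adapted_basis_adj_unitary.
split=> //; split=> //; split=> //; split.
  move=> X; rewrite XTV; split.
    by move=> [X' /XTE [x ->] ->]; exists x; rewrite embed_adapted_basis BVE.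
  move=> [x ->]; rewrite embed_adapted_basis BVE.
  by exists (blkmx B rho x) => //; apply/XTE; exists x.
exists pi; split=> //; exists U; split=> [k|x]; first exact/unitarymx_adjP.
by rewrite !embed_adapted_basis !BVE TVV TU.
Qed.
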